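(* Let $r,n,d$ be positive integers. Then there exists $c=c(r,n,d)$ such that the following holds for every $0<\epsilon<1/4$. Let $\mathcal{H}$ be a strongly-algebraic $r$-uniform hypergraph of complexity $(n,d)$. Then $V(\mathcal{H})$ has an equitable partition $V_1,\dots,V_K$ with $$\frac{8}{\epsilon}<K<c\left(\frac{1}{\epsilon}\right)^{r!(2n+1)}$$ parts such that all but at most an $\epsilon$-fraction of the $r$-tuples of parts are either empty, or have density at least $1-\epsilon$.
   Context: All hypergraphs are finite. For a set $V$, $V^{(s)}$ denotes the family of $s$-element subsets of $V$. An $r$-uniform hypergraph $\mathcal{H}$ is strongly-algebraic of complexity $(n,d)$ if there is a field $\mathbb{F}$ such that $V(\mathcal{H})$ is a (finite) subset of $\mathbb{F}^n$, and there exists a single polynomial $f:(\mathbb{F}^n)^r\to\mathbb{F}$ of degree at most $d$ such that $\{\mathbf{v}_1,\dots,\mathbf{v}_r\}\in V(\mathcal{H})^{(r)}$ is an edge if and only if $f(\mathbf{v}_1,\dots,\mathbf{v}_r)\neq 0$; it is assumed that the truth of $f(\mathbf{v}_1,\dots,\mathbf{v}_r)=0$ is invariant under permutations of $\mathbf{v}_1,\dots,\mathbf{v}_r$. For disjoint $V_1,\dots,V_r\subset V(\mathcal{H})$, let $E(V_1,\dots,V_r)$ be the set of edges containing exactly one vertex from each of $V_1,\dots,V_r$. The density of $(V_1,\dots,V_r)$ is $d(V_1,\dots,V_r)=\frac{|E(V_1,\dots,V_r)|}{|V_1|\cdots|V_r|}$. The $r$-tuple $(V_1,\dots,V_r)$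 is empty if $E(V_1,\dots,V_r)=\emptyset$. A partition of $V(\mathcal{H})$ into parts $V_1,\dots,V_K$ is equitable if the sizes of $V_1,\dots,V_K$ differ by at most $1$ (parts are allowed to be empty sets, which is relevant when $|V(\mathcal{H})|<K$). The $r$-tuples of parts are indexed by the $r$-element subsets of $\{1,\dots,K\}$, so there are $\binom{K}{r}$ of them. *)

(* Defs.v *)
From mathcomp Require Import all_boot all_order all_algebra all_fingroup.
From mathcomp Require Import finmap.
From mathcomp.multinomials Require Import mpoly.

Set Implicit Arguments.
Unset Strict Implicit.
Unset Printing Implicit Defensive.

Import GRing.Theory Num.Theory.

Local Open Scope ring_scope.
Local Open Scope fset_scope.

Record hypergraph (T : choiceType) (r : nat) := Hypergraph {
  vertices : {fset T};
  edges : {fset {fset T}};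
  edge_uniform : forall e, e \in edges -> e `<=` vertices /\ #|` e| = r
}.

(* The value f(v_1, ..., v_r), where a polynomial on (F^n)^r is a polynomial
   in the r * n entries of the matrix with rows v_1, ..., v_r. *)
Definition eval_pts (F : fieldType) (n r : nat) (f : {mpoly F[r * n]})
    (v : 'I_r -> 'rV[F]_n) : F :=
  f.@[fun k => mxvec (\matrix_(i < r) v i) 0 k].

(* [msize f <= d.+1] says that f has total degree at most d.  The invariance
   under permutations is only required at r pairwise distinct vertices, where
   it expresses that f decides the edges independently of their enumeration. *)
Definition strongly_algebraic (F : fieldType) (n r d : nat)
    (H : hypergraph 'rV[F]_n r) : Prop :=
  exists2 f : {mpoly F[r * n]}, (msize f <= d.+1)%N &
    forall v : 'I_r -> 'rV[F]_n,
      injective v -> (forall i, v i \in vertices H) ->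
      (forall s : 'S_r, eval_pts f (v \o s) = 0 <-> eval_pts f v = 0) /\
      ([fset v i | i : 'I_r] \in edges H <-> eval_pts f v != 0).

Section Partition.

Variables (T : choiceType) (r : nat) (H : hypergraph T r).
Variables (K : nat) (V : 'I_K -> {fset T}).

Definition equitable_partition : Prop :=
  [/\ forall x, (x \in vertices H) = [exists i, x \in V i],
      forall i j, i != j -> [disjoint V i & V j]%fset
    & forall i j, (#|` V i| <= #|` V j|.+1)%N].

(* An r-tuple of parts is given by an r-element set [I] of indices. *)
Definition crossing_edges (I : {set 'I_K}) : {fset {fset T}} :=
  [fset e in edges H | [forall i in I, #|` e `&` V i| == 1%N]].

Definition empty_tuple (I : {set 'I_K}) : bool := crossing_edges I == fset0.

(* This is 0 (division by 0) if some part is empty; the tuple is then empty. *)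
Definition density (R : realFieldType) (I : {set 'I_K}) : R :=
  #|` crossing_edges I|%:R / (\prod_(i in I) #|` V i|)%N%:R.

Definition bad_tuples (R : realFieldType) (eps : R) : {set {set 'I_K}} :=
  [set I : {set 'I_K} | (#|I| == r)
     && ~~ (empty_tuple I || (1 - eps <= density R I))].

End Partition.

(* Main.v *)
From mathcomp.multinomials Require Import mpoly.
Require Import Defs.
From mathcomp Require Import all_boot all_order all_algebra finmap reals.
From mathcomp Require Import zify ring lra.

(**
Write N for the number of vertices, and call an r-tuple of vertices an edge if
its entries form an edge.  Fix all entries of a tuple but the i-th.  Whether
the tuple is an edge is then decided, as a function of the remaining entry x,
by finitely many polynomials of bounded degree in the n coordinates of x
([link_edge]).  Such polynomials have two virtues.

They have few zero patterns ([zero_pattern_bound]).  As in Haussler's packing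
lemma, the vertices therefore split into p classes, with p^3 of
order at most (1/delta)^(4n), such that exchanging a vertex of a tuple for
another one of its class changes the status of at most delta N^r tuples
([packing_classes]).  Averaging the indicator h of the edges over the classes
of all coordinates thus gives a function theta, constant on products of
classes, whose l1-distance from h is small ([dist_avgs]).  This alone yields
tuples of classes of density near 0 or near 1.

They also span a space of bounded dimension.  Hence in each class, after
removing a small fraction of atypical vertices, every link that is nonzero on
less than a tau-fraction of the class vanishes on what remains
([few_exceptional_points]).  Applied to the coordinates in turn, this shows
theta >= tau^r at each edge whose vertices are all typical ([avgs_trimmed],
[theta_ge]): a product of classes that is too sparse contains no edge at all
between its typical vertices.

To obtain an equitable partition, list the vertices class by class, with the
atypical ones as an extra class, and cut the list into K intervals.  At most
p + 1 intervals are mixed, and few consist of atypical vertices.  A tuple of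
the other intervals that contains an edge but has density below 1 - eps
contributes much to the l1-distance of theta and h, either because theta is
between tau^r and 1/2 there, or because theta > 1/2 while an eps-fraction of
the tuples are non-edges ([box_deviation]).  So there are few of these
([card_bad]).  With tau proportional to eps and delta to eps^(r+1), the number
of classes is small against eps K for K of the order of
(1/eps)^(r!(2n+1)).
*)

Set Implicit Arguments.
Unset Strict Implicit.
Unset Printing Implicit Defensive.

Import Order.TTheory GRing.Theory Num.Theory.

Local Open Scope ring_scope.

(** * Polynomial functions on a finite point set *)

Lemma card_bigcup_le (I T : finType) (A : I -> {set T}) :
  (#|\bigcup_i A i| <= \sum_i #|A i|)%N.
Proof.
apply: (big_ind2 (fun (B : {set T}) m => #|B| <= m)%N) => //.
  by rewrite cards0.
move=> B m C k Bm Ck.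
by apply: leq_trans (leq_card_setU B C) _; rewrite leq_add.
Qed.

Section PolynomialFunctions.

Variables (F : fieldType) (n : nat) (T : finType) (pt : T -> 'rV[F]_n).

Definition monomial_at (e : 'I_n -> nat) (x : T) : F :=
  \prod_(j < n) pt x 0 j ^+ e j.

(** The degree is bounded in each variable separately: such functions still
    multiply with additive bounds, and they lie in a space whose dimension
    (D + 1)^n does not depend on the number of points. *)
Definition polyfun (D : nat) (g : T -> F) : Prop :=
  exists a : {ffun 'I_n -> 'I_D.+1} -> F,
    forall x, g x = \sum_e a e * monomial_at (fun j => e j) x.

Lemma polyfun_eq D (g h : T -> F) : g =1 h -> polyfun D g -> polyfun D h.
Proof. by move=> gh [a ga]; exists a => x; rewrite -gh ga. Qed.

Lemma polyfun_monomial D (e : 'I_n -> nat) :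
  (forall j, e j <= D)%N -> polyfun D (monomial_at e).
Proof.
move=> eD; pose e' := [ffun j => inord (e j) : 'I_D.+1].
exists (fun e0 => (e0 == e')%:R) => x.
rewrite (bigD1 e') //= eqxx mul1r big1 ?addr0 => [|e0 /negbTE ->]; last first.
  by rewrite mul0r.
by apply: eq_bigr => j _; rewrite ffunE inordK // ltnS.
Qed.

Lemma polyfun_scale D c (g : T -> F) :
  polyfun D g -> polyfun D (fun x => c * g x).
Proof.
case=> a ga; exists (fun e => c * a e) => x.
by rewrite ga mulr_sumr; apply: eq_bigr => e _; rewrite mulrA.
Qed.

Lemma polyfun_sum D (I : Type) (s : seq I) (P : pred I) (g : I -> T -> F) :
  (forall i, P i -> polyfun D (g i)) ->
  polyfun D (fun x => \sum_(i <- s | P i) g i x).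
Proof.
move=> pg; elim: s => [|i s [a IH]].
  by exists (fun=> 0) => x; rewrite big_nil big1 // => e _; rewrite mul0r.
case Pi: (P i); last by exists a => x; rewrite big_cons Pi IH.
have [b gb] := pg _ Pi; exists (fun e => b e + a e) => x.
rewrite big_cons Pi IH gb -big_split; apply: eq_bigr => e _.
by rewrite mulrDl.
Qed.

Lemma polyfun_const c : polyfun 0 (fun=> c).
Proof.
apply: (@polyfun_eq _ (fun x => c * monomial_at (fun=> 0%N) x)).
  by move=> x; rewrite /monomial_at big1 ?mulr1.
exact/polyfun_scale/polyfun_monomial.
Qed.

Lemma polyfun_coord j : polyfun 1 (fun x => pt x 0 j).
Proof.
apply: (@polyfun_eq _ (monomial_at (fun i => (i == j)%N))).
  move=> x; rewrite /monomial_at (bigD1 j) //= eqxx expr1 big1 ?mulr1 //.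
  by move=> i /negbTE ->.
by apply: polyfun_monomial => i; case: eqP.
Qed.

Lemma polyfun_mul D1 D2 (g h : T -> F) :
  polyfun D1 g -> polyfun D2 h -> polyfun (D1 + D2) (fun x => g x * h x).
Proof.
case=> a ga [b hb].
apply: (@polyfun_eq _ (fun x => \sum_e \sum_(e' : {ffun 'I_n -> 'I_D2.+1})
    (a e * b e') * monomial_at (fun j => e j + e' j)%N x)).
  move=> x; rewrite ga hb mulr_suml; apply: eq_bigr => e _.
  rewrite mulr_sumr; apply: eq_bigr => e' _.
  rewrite mulrACA; congr (_ * _).
  by rewrite /monomial_at -big_split; apply: eq_bigr => j _; rewrite exprD.
apply: polyfun_sum => e _; apply: polyfun_sum => e' _.
apply/polyfun_scale/polyfun_monomial => j.
by apply: leq_add; rewrite -ltnS.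
Qed.

Lemma polyfun_leq D1 D2 (g : T -> F) :
  (D1 <= D2)%N -> polyfun D1 g -> polyfun D2 g.
Proof.
move=> D12 [a ga].
apply: (@polyfun_eq _ (fun x => \sum_e a e * monomial_at (fun j => e j) x)) => [x|].
  by rewrite ga.
apply: polyfun_sum => e _; apply/polyfun_scale/polyfun_monomial => j.
by rewrite (leq_trans _ D12) // -ltnS.
Qed.

Lemma polyfun_sub D (g h : T -> F) :
  polyfun D g -> polyfun D h -> polyfun D (fun x => g x - h x).
Proof.
case=> a ga [b hb]; exists (fun e => a e - b e) => x.
by rewrite ga hb -sumrB; apply: eq_bigr => e _; rewrite mulrBl.
Qed.

Lemma polyfun_prod (I : Type) (s : seq I) (P : pred I) (D : I -> nat)
    (g : I -> T -> F) :
  (forall i, P i -> polyfun (D i) (g i)) ->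
  polyfun (\sum_(i <- s | P i) D i) (fun x => \prod_(i <- s | P i) g i x).
Proof.
move=> pg; elim: s => [|i s IH].
  rewrite big_nil; apply: polyfun_eq (polyfun_const 1) => x.
  by rewrite big_nil.
rewrite big_cons; case Pi: (P i); last first.
  by apply: polyfun_eq IH => x; rewrite big_cons Pi.
apply: polyfun_eq (polyfun_mul (pg _ Pi) IH) => x.
by rewrite big_cons Pi.
Qed.

Lemma polyfun_exp D k (g : T -> F) :
  polyfun D g -> polyfun (k * D) (fun x => g x ^+ k).
Proof.
move=> pg; elim: k => [|k IH].
  by apply: polyfun_eq (polyfun_const 1) => x; rewrite expr0.
by rewrite mulSn; apply: polyfun_eq (polyfun_mul pg IH) => x; rewrite exprS.
Qed.

(** The matrix of values factors through the (D + 1)^n monomials. *)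
Lemma polyfun_rank D m (g : 'I_m -> T -> F) :
  (forall i, polyfun D (g i)) ->
  (\rank (\matrix_(i < m, k < #|T|) g i (enum_val k)) <= D.+1 ^ n)%N.
Proof.
move=> pg; pose E := {ffun 'I_n -> 'I_D.+1}.
have /fin_all_exists [a ga] := pg.
pose A := \matrix_(i < m, k < #|E|) a i (enum_val k).
pose B := \matrix_(k < #|E|, l < #|T|)
  monomial_at (fun j => (enum_val k : E) j) (enum_val l).
have -> : \matrix_(i < m, k < #|T|) g i (enum_val k) = A *m B.
  apply/matrixP => i l; rewrite !mxE ga (reindex_onto enum_val enum_rank) /=.
    rewrite (eq_bigl predT); last by move=> k; rewrite enum_valK eqxx.
    by apply: eq_bigr => k _; rewrite !mxE.
  by move=> e _; rewrite enum_rankK.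
apply: leq_trans (mxrankM_maxl _ _) _; apply: leq_trans (rank_leq_col _) _.
by rewrite card_ffun !card_ord.
Qed.

(** The zero-pattern theorem of Ronyai, Babai and Ganapathy.  For a point x
    let G x be the product of the f j with f j x != 0.  Then G x y != 0 exactly
    when the support of x is contained in that of y, so for points with
    pairwise distinct supports the matrix of the G x y is triangular once the
    points are ordered by the size of their supports.  The G x are thus
    linearly independent, and the dimension of their space bounds #|X|. *)
Lemma zero_pattern_bound (J : finType) D (f : J -> T -> F) (X : {set T}) :
  (forall j, polyfun D (f j)) ->
  {in X &, forall x y, (forall j, (f j x == 0) = (f j y == 0)) -> x = y} ->
  (#|X| <= (#|J| * D).+1 ^ n)%N.
Proof.
move=> pf sepX.
pose supp x := [set j | f j x != 0].
pose G x y := \prod_(j in supp x) f j y.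
have G0 x y : (G x y != 0) = (supp x \subset supp y).
  rewrite prodf_seq_neq0; apply/allP/subsetP => [H j jx|H j _].
    by have := H j (mem_index_enum _); rewrite jx inE.
  by apply/implyP => /H; rewrite inE.
have pG x : polyfun (#|J| * D) (G x).
  apply: polyfun_leq (polyfun_prod _ (fun j _ => pf j)).
  by rewrite sum_nat_const leq_mul2r max_card orbT.
apply: leq_trans (polyfun_rank (fun k : 'I_#|X| => pG (enum_val k))).
rewrite [X in (_ <= X)%N](_ : _ = #|X|) //; apply/eqP/inj_row_free => u uG0.
(* In a linear relation u between the rows, look at the column of a point of
   smallest support among those with a nonzero coefficient: only the diagonal
   term survives there. *)
apply/eqP; apply: contraT => /rV0Pn [k0 uk0].
pose P k := u 0 k != 0.
case: (@arg_minnP _ k0 P (fun k => #|supp (enum_val k)|)) => // k Pk kmin.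
have := congr1 (fun w : 'rV_#|T| => w 0 (enum_rank (enum_val k))) uG0.
rewrite !mxE (bigD1 k) //= !mxE enum_rankK big1 ?addr0.
  move/eqP; rewrite mulf_eq0 (negbTE Pk) /= => /negPn /negP [].
  by rewrite G0.
move=> l lk; rewrite !mxE enum_rankK.
case: (eqVneq (u 0 l) 0) => [->|Pl]; first by rewrite mul0r.
case: (eqVneq (G (enum_val l) (enum_val k)) 0) => [->|]; first by rewrite mulr0.
rewrite G0 => sub_lk.
have : supp (enum_val l) == supp (enum_val k).
  by rewrite eqEcard sub_lk kmin.
move=> /eqP eq_supp; case/negP: lk; apply/eqP/enum_val_inj.
apply: sepX; try exact: enum_valP.
move=> j; have := congr1 (fun S : {set J} => j \in S) eq_supp.
by rewrite !inE => /negb_inj.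
Qed.

(** This turns mostly zero into exactly zero.  The functions that vanish at
    all but fewer than t points of A span a space of dimension at most
    (D + 1)^n; choosing a basis among them, a point of A where one of them is
    nonzero is a nonzero of a basis member, and each basis member has fewer
    than t of these. *)
Lemma few_exceptional_points (R : realDomainType) (I : finType) D
    (g : I -> T -> F) (A : {set T}) (t : R) :
  0 <= t -> (forall i, polyfun D (g i)) ->
  #|[set x in A | [exists i,
      (#|[set y in A | g i y != 0%R]|%:R < t) && (g i x != 0%R)]]|%:R
    <= (D.+1 ^ n)%:R * t.
Proof.
move=> t0 pg.
pose good i := #|[set y in A | g i y != 0]|%:R < t.
pose h i x := (good i)%:R * g i x.
have ph i : polyfun D (h i) by apply: polyfun_scale.
pose M := \matrix_(i < #|I|, k < #|T|) h (enum_val i) (enum_val k).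
pose b k := enum_val (maxrankfun M k).
have hb k : #|[set y in A | h (b k) y != 0]|%:R <= t.
  rewrite /h; case gk: (good (b k)).
    apply: le_trans (ltW gk); rewrite ler_nat subset_leq_card //.
    by apply/subsetP => y; rewrite !inE mul1r.
  rewrite (_ : [set y in A | _] = set0) ?cards0 //.
  by apply/setP => y; rewrite !inE mul0r eqxx andbF.
have cover : [set x in A | [exists i, good i && (g i x != 0)]]
   \subset \bigcup_(k < \rank M) [set y in A | h (b k) y != 0].
  apply/subsetP => x; rewrite inE => /andP[xA /existsP[i /andP[gi gix]]].
  apply/bigcupP.
  have /existsP[k hk] : [exists k, h (b k) x != 0].
    apply: contraT => /existsPn nh; case/negP: gix; apply/eqP.
    have : (row (enum_rank i) M <= rowsub (maxrankfun M) M)%MS.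
      by rewrite eq_maxrowsub row_sub.
    case/submxP => u /(congr1 (fun w : 'rV_#|T| => w 0 (enum_rank x))).
    rewrite !mxE !enum_rankK /h gi mul1r => ->.
    rewrite big1 // => k _; rewrite !mxE enum_rankK.
    by have := nh k; rewrite negbK => /eqP ->; rewrite mulr0.
  by exists k; rewrite // inE xA.
apply: (@le_trans _ _ (\sum_(k < \rank M) t)).
  apply: (@le_trans _ _
      (\sum_(k < \rank M) #|[set y in A | h (b k) y != 0%R]|)%N%:R).
    rewrite ler_nat; apply: leq_trans (subset_leq_card cover) _.
    exact: card_bigcup_le.
  by rewrite natr_sum ler_sum.
rewrite sumr_const card_ord -[t *+ _]mulr_natl; apply: ler_wpM2r => //.
rewrite ler_nat; exact: (polyfun_rank (fun i : 'I_#|I| => ph (enum_val i))).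
Qed.

End PolynomialFunctions.

(** * Packing of zero patterns *)

Section Packing.

Variables (R : archiRealFieldType) (T Y : finType) (phi : Y -> T -> bool).

Definition differ (x x' : T) : {set Y} := [set y | phi y x != phi y x'].

(** Averaging over the index y, some y separates at least a delta-fraction of
    the pairs of Q that no earlier index separated; picking such an index m
    times leaves at most (1 - delta)^m * #|Q| pairs. *)
Lemma separating_sample (delta : R) (Q : {set T * T}) (m : nat) :
  delta <= 1 ->
  {in Q, forall q, delta * #|Y|%:R < #|differ q.1 q.2|%:R} ->
  exists2 s : seq Y, (size s <= m)%N &
    #|[set q in Q | all (fun y => phi y q.1 == phi y q.2) s]|%:R
      <= (1 - delta) ^+ m * #|Q|%:R.
Proof.
move=> d1 sepQ; elim: m => [|m [s sm IH]].
  by exists [::]; rewrite // expr0 mul1r ler_nat subset_leq_card //;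
     apply/subsetP => q; rewrite inE => /andP[].
set Q' := [set q in Q | _] in IH.
case: (set_0Vmem Q') => [Q'0|[q0 Q'q0]].
  exists s; first by rewrite leqW.
  by rewrite -/Q' Q'0 cards0 mulr_ge0 // exprn_ge0 // subr_ge0.
have [y hy] : exists y, delta * #|Q'|%:R
    <= #|[set q in Q' | y \in differ q.1 q.2]|%:R.
  apply/existsP; apply: contraT => /existsPn ny.
  suff : delta * #|Q'|%:R * #|Y|%:R < delta * #|Q'|%:R * #|Y|%:R.
    by rewrite ltxx.
  apply: (@lt_le_trans _ _ (\sum_(q in Q') #|differ q.1 q.2|)%N%:R).
    rewrite natr_sum mulrAC mulr_natr -sumr_const.
    apply: ltr_sum => [|q]; first by apply/hasP; exists q0; rewrite ?mem_index_enum.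
    by rewrite inE => /andP[/sepQ].
  have -> : (\sum_(q in Q') #|differ q.1 q.2| =
      \sum_y #|[set q in Q' | y \in differ q.1 q.2]|)%N.
    transitivity (\sum_(q in Q') \sum_y (y \in differ q.1 q.2))%N.
      apply: eq_bigr => q _; rewrite -sum1_card big_mkcond.
      by apply: eq_bigr => y _; case: (y \in _).
    rewrite exchange_big /=; apply: eq_bigr => y _.
    rewrite -sum1_card [RHS]big_mkcond [LHS]big_mkcond /=.
    apply: eq_bigr => q _; rewrite [in RHS]in_set.
    by case: (q \in Q'); case: (y \in _).
  rewrite natr_sum mulr_natr -sumr_const ler_sum // => y _.
  by rewrite ltW // ltNge ny.
exists (y :: s); first by rewrite ltnS.
rewrite exprS -mulrA.
have -> : [set q in Q | all (fun y => phi y q.1 == phi y q.2) (y :: s)]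
   = Q' :\: [set q in Q' | y \in differ q.1 q.2].
  apply/setP => q; rewrite !inE /=; case: (q \in Q) => //=.
  by case: (all _ s); case: (phi y q.1 == _) => //=.
rewrite cardsD (setIidPr _); last by apply/subsetP => q; rewrite inE => /andP[].
rewrite natrB; last by apply/subset_leq_card/subsetP => q; rewrite inE => /andP[].
apply: (@le_trans _ _ ((1 - delta) * #|Q'|%:R)).
  by rewrite mulrBl mul1r lerB.
by rewrite ler_wpM2l // subr_ge0.
Qed.

(** A separated set of maximal cardinality is also a net.  The maximum with 0
    accounts for the point itself when delta is negative. *)
Lemma packing_net (delta : R) : exists2 X : {set T},
  {in X &, forall x x', x != x' -> delta * #|Y|%:R < #|differ x x'|%:R} &
  forall x, exists2 z, z \in X & #|differ x z|%:R <= Num.max 0 (delta * #|Y|%:R).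
Proof.
pose P (X : {set T}) := [forall x in X, forall x' in X,
  (x != x') ==> (delta * #|Y|%:R < #|differ x x'|%:R)].
have P0 : P set0 by apply/forall_inP => x; rewrite inE.
have [X PX maxX] := @arg_maxnP _ set0 P (fun X => #|X|) P0.
have sepX : {in X &, forall x x', x != x' ->
    delta * #|Y|%:R < #|differ x x'|%:R}.
  by move=> x x' xX x'X /(implyP (forall_inP (forall_inP PX x xX) x' x'X)).
exists X => // x; case xX: (x \in X).
  exists x => //; rewrite (_ : differ x x = set0) ?cards0 ?le_max ?lexx //.
  by apply/setP => y; rewrite !inE eqxx.
apply/exists_inP; apply: contraT => /exists_inPn nz.
have nz' z : z \in X -> delta * #|Y|%:R < #|differ x z|%:R.
  by move/nz; rewrite -ltNge gt_max => /andP[].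
have differC z z' : differ z z' = differ z' z.
  by apply/setP => y; rewrite !inE eq_sym.
have : P (x |: X).
  apply/forall_inP => z /setU1P[->|zX]; apply/forall_inP => z' /setU1P[->|z'X];
    apply/implyP; rewrite ?eqxx // => zz'.
  - exact: nz'.
  - by rewrite differC; apply: nz'.
  - exact: sepX.
by move/maxX; rewrite cardsU1 xX /= ltnn.
Qed.

End Packing.

Lemma bernoulli (R : realFieldType) (t : R) (k : nat) :
  0 <= t -> 1 + k%:R * t <= (1 + t) ^+ k.
Proof.
move=> t0; elim: k => [|k IH]; first by rewrite expr0 mul0r addr0.
have : 0 <= k%:R * t ^+ 2 by rewrite mulr_ge0 // exprn_ge0.
have : (1 + t) * (1 + k%:R * t) <= (1 + t) * (1 + t) ^+ k.
  by rewrite ler_wpM2l // addr_ge0.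
by rewrite -exprS -natr1; lra.
Qed.

Section PolynomialPacking.

Variables (R : archiRealFieldType) (F : fieldType) (n : nat) (T : finType).
Variables (pt : T -> 'rV[F]_n) (Y C : finType) (D : nat).
Variables (g : Y -> C -> T -> F).
Hypothesis g_poly : forall y c, polyfun pt D (g y c).

Let phi (y : Y) (x : T) : bool := [exists c, g y c x != 0].

(** A sample of m indices that separates all pairs of X gives the points of X
    pairwise distinct zero patterns with respect to m * #|C| polynomials. *)
Lemma separated_card_le (delta : R) (X : {set T}) (m : nat) :
  delta <= 1 ->
  {in X &, forall x x', x != x' -> delta * #|Y|%:R < #|differ phi x x'|%:R} ->
  (1 - delta) ^+ m * (#|X| ^ 2)%:R < 1 ->
  (#|X| <= (m * #|C| * D).+1 ^ n)%N.
Proof.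
move=> d1 sepX m_large.
pose Q := [set q in setX X X | q.1 != q.2].
have [q|s sm] := separating_sample m d1 (Q := Q) (phi := phi).
  by rewrite !inE => /andP[/andP[]]; apply: sepX.
set Z := [set q in Q | _] => Zle.
have Z0 : Z = set0.
  apply/eqP; rewrite -cards_eq0 -leqn0 -ltnS -(ltr_nat R).
  apply: le_lt_trans Zle (le_lt_trans _ m_large).
  rewrite ler_wpM2l ?exprn_ge0 ?subr_ge0 // ler_nat.
  rewrite -mulnn -cardsX subset_leq_card //.
  by apply/subsetP => q; rewrite inE => /andP[].
apply: (@leq_trans ((#|{: 'I_(size s) * C}| * D).+1 ^ n)); last first.
  rewrite card_prod card_ord; case: (n) => // n'; rewrite leq_exp2r //.
  by rewrite ltnS !leq_mul2r sm !orbT.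
apply: (@zero_pattern_bound _ _ _ pt _ D
  (fun j : 'I_(size s) * C => g (tnth (in_tuple s) j.1) j.2)) => //.
move=> x x' xX x'X eq_pat; apply/eqP; apply: contraT => xx'.
suff : (x, x') \in Z by rewrite Z0 inE.
rewrite !inE xX x'X xx' /=; apply/allP => y ys.
have /tnthP[j ->] : y \in in_tuple s by [].
by apply/eqP/eq_existsb => c; rewrite (eq_pat (j, c)).
Qed.

(** A polynomial form of Haussler's packing bound.  The sample size has to
    exceed log #|X| / delta; bounding the logarithm by #|X|^(1/4n), which is
    the role of q below, costs only the exponent 4n/3 in place of n, and this
    loss is affordable. *)
Lemma separated_card_cube (delta : R) (X : {set T}) :
  (0 < n)%N -> 0 < delta -> delta <= 1 ->
  {in X &, forall x x', x != x' -> delta * #|Y|%:R < #|differ phi x x'|%:R} ->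
  #|X|%:R ^+ 3 * delta ^+ (4 * n)
    <= ((2 * (16 * n * #|C| * D).+1) ^ (4 * n))%:R.
Proof.
move=> n0 d0 d1 sepX; have n40 : (0 < 4 * n)%N by rewrite muln_gt0.
set p := #|X|; case: (posnP p) => [->|p0].
  by rewrite expr0n mul0r.
have [q [pq qp]] : exists q, (p <= q ^ (4 * n) /\ q ^ (4 * n) <= 2 ^ (4 * n) * p)%N.
  have ex : exists q, (p <= q ^ (4 * n))%N.
    by exists p; rewrite -{1}[p]expn1 leq_pexp2l.
  case: (ex_minnP ex) => q pq qmin; exists q; split=> //.
  case: q pq qmin => [|[|q]] pq qmin.
  - by rewrite exp0n.
  - by rewrite exp1n muln_gt0 expn_gt0.
  have : (q.+1 ^ (4 * n) < p)%N.
    by rewrite ltnNge; apply/negP => /qmin; rewrite ltnn.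
  move=> /ltnW qp; apply: (@leq_trans ((2 * q.+1) ^ (4 * n))).
    by rewrite leq_exp2r //; lia.
  by rewrite expnMn leq_mul2l qp orbT.
have q0 : (0 < q)%N by case: q pq {qp} => //; rewrite exp0n // leqn0; case: p p0.
(* With m = 8 n l and l > q / delta, Bernoulli gives
   (1 + delta)^m > q^(8n) >= p^2, which beats the number of pairs. *)
pose l := (Num.truncn (q%:R / delta)).+1.
have qd : 1 <= q%:R / delta.
  by rewrite ler_pdivlMr // mul1r (le_trans d1) // ler1n.
have l1 : q%:R / delta < l%:R by rewrite truncnS_gt.
have l2 : l%:R <= 2 * (q%:R / delta).
  rewrite /l -natr1 mulr2n mulrDl !mul1r lerD // truncn_le //.
  by rewrite (le_trans _ qd).
have p_le : (p <= ((8 * n * l) * #|C| * D).+1 ^ n)%N.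
  apply: (separated_card_le d1 sepX).
  have ineq : (1 - delta) ^+ (8 * n * l) * (1 + delta) ^+ (8 * n * l) <= 1.
    rewrite -exprMn exprn_ile1 //; nra.
  have big : (p ^ 2)%:R < (1 + delta) ^+ (8 * n * l).
    apply: (@le_lt_trans _ _ (q%:R ^+ (8 * n))).
      rewrite -natrX ler_nat (_ : 8 * n = 4 * n * 2)%N; last by lia.
      by rewrite expnM leq_exp2r.
    rewrite (mulnC _ l) [X in _ < X]exprM.
    have d2 := addr_ge0 ler01 (ltW d0).
    rewrite ltr_pXn2r ?nnegrE ?muln_gt0 ?n0 ?exprn_ge0 //.
    apply: lt_le_trans (bernoulli l (ltW d0)).
    by rewrite ltr_pdivrMr // in l1; lra.
  case: (eqVneq delta 1) => [->|dn1].
    by rewrite subrr expr0n -[(_ == _)%N]negbK -lt0n !muln_gt0 n0 /= mul0r.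
  apply: lt_le_trans ineq; rewrite ltr_pM2l // exprn_gt0 // subr_gt0.
  by rewrite lt_neqAle dn1.
have p_real : p%:R <= ((16 * n * #|C| * D).+1%:R * (q%:R / delta)) ^+ n :> R.
  apply: (@le_trans _ _ (((8 * n * l * #|C| * D).+1 ^ n)%:R)).
    by rewrite ler_nat.
  rewrite natrX; apply: lerXn2r; rewrite ?nnegrE //.
    by rewrite mulr_ge0 // (le_trans _ qd).
  rewrite -!natr1 mulrDl mul1r lerD //.
  rewrite !natrM.
  have : 0 <= n%:R * #|C|%:R * D%:R :> R by rewrite !mulr_ge0.
  by nra.
set B := (16 * n * #|C| * D).+1 in p_real *.
have p4 : p%:R ^+ 4 * delta ^+ (4 * n) <= B%:R ^+ (4 * n) * q%:R ^+ (4 * n).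
  have : p%:R ^+ 4 <= (B%:R * (q%:R / delta)) ^+ n ^+ 4.
    by apply: lerXn2r; rewrite ?nnegrE // exprn_ge0 // mulr_ge0 // (le_trans _ qd).
  by rewrite -exprM (mulnC n) mulrA expr_div_n ler_pdivlMr ?exprn_gt0 // exprMn.
rewrite -(ler_pM2r (_ : 0 < p%:R)) ?ltr0n // mulrAC -exprSr.
apply: le_trans p4 _; rewrite expnMn !natrM.
rewrite (mulrC (_ ^ _)%:R) -mulrA natrX ler_wpM2l ?exprn_ge0 //.
by rewrite -natrM -natrX ler_nat.
Qed.

(** Points close to the same point of a maximal separated set form a class;
    the triangle inequality costs the factor 2. *)
Lemma packing_classes (delta : R) :
  (0 < n)%N -> 0 < delta -> delta <= 1 ->
  exists (p : nat) (cl : T -> 'I_p),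
    p%:R ^+ 3 * delta ^+ (4 * n)
      <= ((2 * (16 * n * #|C| * D).+1) ^ (4 * n))%:R :> R /\
    forall x x', cl x = cl x' ->
      #|differ phi x x'|%:R <= 2 * delta * #|Y|%:R.
Proof.
move=> n0 d0 d1; have [X sepX netX] := packing_net phi delta.
have /fin_all_exists2[z zX xz] := netX.
exists #|X|, (fun x => enum_rank_in (zX x) (z x)); split.
  exact: separated_card_cube.
move=> x x' /(congr1 enum_val); rewrite !enum_rankK_in // => zz'.
apply: (@le_trans _ _ (#|differ phi x (z x)|%:R + #|differ phi x' (z x')|%:R)).
  rewrite -natrD ler_nat; apply: leq_trans (leq_card_setU _ _).
  apply/subset_leq_card/subsetP => y; rewrite !inE -zz'.
  by move: (phi y x) (phi y x') (phi y (z x)) => [] [] [].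
have := lerD (xz x) (xz x'); rewrite max_r; last by rewrite mulr_ge0 // ltW.
by lra.
Qed.

End PolynomialPacking.

(** * Averaging over classes *)

Definition upd (r : nat) (T : finType) (i : 'I_r) (x : T)
    (v : {ffun 'I_r -> T}) : {ffun 'I_r -> T} :=
  [ffun j => if j == i then x else v j].

Section Averaging.

Variables (R : realFieldType) (r p : nat) (T : finType) (cl : T -> 'I_p).

Local Notation tuples := {ffun 'I_r -> T}.

Lemma upd_upd i x y (v : tuples) : upd i x (upd i y v) = upd i x v.
Proof. by apply/ffunP => j; rewrite !ffunE; case: eqP. Qed.

Lemma upd_id i (v : tuples) : upd i (v i) v = v.
Proof. by apply/ffunP => j; rewrite !ffunE; case: eqP => // ->. Qed.

Lemma upd_at i x (v : tuples) : upd i x v i = x.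
Proof. by rewrite ffunE eqxx. Qed.

Lemma upd_off i x (v : tuples) j : j != i -> upd i x v j = v j.
Proof. by move=> /negbTE ji; rewrite ffunE ji. Qed.

(** The pairs (v, x) and (upd i x v, v i) are exchanged by an involution. *)
Lemma swap_sum (i : 'I_r) (Q : rel T) (G : tuples -> T -> R) :
  symmetric Q ->
  \sum_(v : tuples) \sum_(x | Q (v i) x) G v x
    = \sum_(v : tuples) \sum_(x | Q (v i) x) G (upd i x v) (v i).
Proof.
move=> symQ; rewrite !pair_big_dep /=.
rewrite (reindex_inj (h := fun q : tuples * T => (upd i q.2 q.1, q.1 i))).
  by apply: eq_bigl => q; rewrite upd_at symQ.
apply: (can_inj (g := fun q : tuples * T => (upd i q.2 q.1, q.1 i))).
by move=> [v x]; rewrite /= upd_at upd_upd upd_id.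
Qed.

Definition cls (x : T) : {set T} := [set y | cl y == cl x].

Lemma cls_gt0 x : 0 < #|cls x|%:R :> R.
Proof. by rewrite ltr0n; apply/card_gt0P; exists x; rewrite inE. Qed.

Lemma cls_eq x y : cl x = cl y -> cls x = cls y.
Proof. by move=> xy; apply/setP => z; rewrite !inE xy. Qed.

(** The conditional expectation of h when coordinate i is forgotten up to its
    class. *)
Definition avg (i : 'I_r) (h : tuples -> R) (v : tuples) : R :=
  (\sum_(x in cls (v i)) h (upd i x v)) / #|cls (v i)|%:R.

Lemma avg_const (h : tuples -> R) i v c :
  (forall x, h (upd i x v) = c) -> avg i h v = c.
Proof.
move=> hc; rewrite /avg (eq_bigr (fun=> c)) // sumr_const -[c *+ _]mulr_natr.
by rewrite mulfK // gt_eqF // cls_gt0.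
Qed.

Lemma avgB (h k : tuples -> R) i v :
  avg i (fun u => h u - k u) v = avg i h v - avg i k v.
Proof. by rewrite /avg sumrB mulrBl. Qed.

Lemma avgZ (h : tuples -> R) c i v :
  avg i (fun u => c * h u) v = c * avg i h v.
Proof. by rewrite /avg -mulr_sumr mulrA. Qed.

Lemma avg_le (h k : tuples -> R) i (v : tuples) :
  (forall x, x \in cls (v i) -> h (upd i x v) <= k (upd i x v)) ->
  avg i h v <= avg i k v.
Proof. by move=> hk; rewrite ler_pM2r ?invr_gt0 ?cls_gt0 // ler_sum. Qed.

Lemma norm_avg (h : tuples -> R) i v :
  `|avg i h v| <= avg i (fun u => `|h u|) v.
Proof.
rewrite /avg normrM normfV (ger0_norm (ltW (cls_gt0 _))) ler_wpM2r ?invr_ge0 //.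
exact: ler_norm_sum.
Qed.

Lemma sum_avg (h : tuples -> R) i :
  \sum_(v : tuples) avg i h v = \sum_(v : tuples) h v.
Proof.
under eq_bigr => v _ do rewrite /avg mulr_suml.
under eq_bigr => v _ do (under eq_bigl => x do rewrite inE eq_sym).
rewrite (@swap_sum i (fun x y => cl x == cl y)); last by move=> x y; exact: eq_sym.
apply: eq_bigr => v _.
have -> : h v = avg i (fun=> h v) v by rewrite (@avg_const _ _ _ (h v)).
rewrite /avg mulr_suml; apply: eq_big => x; first by rewrite inE eq_sym.
by move=> xv; rewrite upd_upd upd_id upd_at (@cls_eq x (v i)) // (eqP xv).
Qed.

(** Averaging preserves sums, by the exchange of v i with the new value, so it
    does not increase the l1-norm. *)
Lemma avg_contraction (h : tuples -> R) i :
  \sum_(v : tuples) `|avg i h v| <= \sum_(v : tuples) `|h v|.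
Proof.
rewrite -[leRHS](sum_avg _ i); apply: ler_sum => v _; exact: norm_avg.
Qed.

(** A tuple v amounts to a value x = v i together with the other coordinates.
    For fixed x, the hypothesis bounds the sum over the other coordinates for
    each x' in the class of x; it remains to average over x' and x. *)
Lemma dist_avg (h : tuples -> R) i (B : R) :
  0 <= B ->
  (forall x x', cl x = cl x' ->
     \sum_(v : tuples) `|h (upd i x v) - h (upd i x' v)| <= B) ->
  \sum_(v : tuples) `|avg i h v - h v| <= B.
Proof.
move=> B0 hB.
pose G (v : tuples) x :=
  (\sum_(y in cls x) `|h (upd i y v) - h (upd i x v)|) / #|cls x|%:R.
have le1 v : `|avg i h v - h v| <= G v (v i).
  rewrite -{1}(@avg_const (fun=> h v) i v (h v)) // -avgB.
  by apply: le_trans (norm_avg _ _ _) _; rewrite /avg /G upd_id.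
apply: le_trans (ler_sum _ (fun v _ => le1 v)) _.
have GE v x y : G (upd i y v) x = G v x.
  by congr (_ / _); apply: eq_bigr => z _; rewrite !upd_upd.
case: (posnP #|T|) => [T0|T0].
  by rewrite big1 // => v _; have := fintype0 (v i) T0.
have T0' : 0 < #|T|%:R :> R by rewrite ltr0n.
rewrite -(ler_pM2r T0') mulr_suml.
have -> : \sum_(v : tuples) G v (v i) * #|T|%:R = \sum_(v : tuples) \sum_x G v x.
  rewrite (@swap_sum i (fun _ _ => true)) //; apply: eq_bigr => v _.
  rewrite mulr_natr -sumr_const; apply: eq_bigr => x _.
  by rewrite GE.
rewrite exchange_big mulr_natr -sumr_const; apply: ler_sum => x _ /=.
rewrite /G -mulr_suml ler_pdivrMr ?cls_gt0 // exchange_big mulr_natr -sumr_const.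
by apply: ler_sum => y; rewrite inE => /eqP /hB.
Qed.

Definition avgs (s : seq 'I_r) (h : tuples -> R) : tuples -> R :=
  foldr avg h s.

(** A telescoping sum: one more average moves the function by at most B, and
    the contraction property carries the earlier errors through. *)
Lemma dist_avgs (h : tuples -> R) (B : R) s :
  0 <= B ->
  (forall i x x', cl x = cl x' ->
     \sum_(v : tuples) `|h (upd i x v) - h (upd i x' v)| <= B) ->
  \sum_(v : tuples) `|avgs s h v - h v| <= (size s)%:R * B.
Proof.
move=> B0 hB; elim: s => [|i s IH] /=.
  by rewrite mul0r big1 // => v _; rewrite subrr normr0.
apply: (@le_trans _ _ (\sum_(v : tuples) (`|avg i (fun u => avgs s h u - h u) v|
   + `|avg i h v - h v|))).
  apply: ler_sum => v _; rewrite avgB; apply: le_trans (ler_normD _ _).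
  by rewrite addrA subrK.
rewrite big_split -natr1 mulrDl mul1r lerD ?dist_avg //=.
  exact: le_trans (avg_contraction _ _) IH.
by move=> x x'; apply: hB.
Qed.

(** Once all coordinates are averaged, the value depends on the classes of the
    coordinates alone. *)
Lemma avgs_class (h : tuples -> R) s (u v : tuples) :
  (forall j, j \notin s -> u j = v j) -> (forall j, cl (u j) = cl (v j)) ->
  avgs s h u = avgs s h v.
Proof.
elim: s u v => [|i s IH] u v off same /=.
  by congr h; apply/ffunP => j; rewrite off.
rewrite /avg (cls_eq (same i)); congr (_ / _); apply: eq_bigr => x _.
apply: IH => j; rewrite !ffunE; case: eqP => // /eqP ji js; apply: off.
by rewrite inE negb_or ji.
Qed.

Lemma avgs_le (P : tuples -> Prop) (h k : tuples -> R) s :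
  (forall i x v, i \in s -> P v -> P (upd i x v)) ->
  (forall v, P v -> h v <= k v) ->
  forall v, P v -> avgs s h v <= avgs s k v.
Proof.
elim: s => [|i s IH] stable hk v Pv; first exact: hk.
rewrite /=.
apply: avg_le => x _; apply: IH => //.
  by move=> j y w js; apply: stable; rewrite inE js orbT.
by apply: stable; rewrite ?mem_head.
Qed.

Lemma avgsZ (h : tuples -> R) c s v :
  avgs s (fun u => c * h u) v = c * avgs s h v.
Proof.
elim: s v => [|i s IH] v //=; rewrite -avgZ /avg.
by congr (_ / _); apply: eq_bigr => x _; rewrite IH.
Qed.

(** At a tuple whose coordinate i is good, averaging over i loses at most a
    factor tau.  The averages are added at the inner end of the list, so that
    this applies to h itself, and the outer averages, which leave coordinate i
    alone, preserve the inequality. *)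
Lemma avgs_trimmed (h : tuples -> R) (tau : R) (good : {set T}) s :
  0 <= tau -> uniq s ->
  (forall i (v : tuples), v i \in good -> tau * h v <= avg i h v) ->
  forall v : tuples, (forall i, v i \in good) ->
  tau ^+ size s * h v <= avgs s h v.
Proof.
move=> tau0 + hgood v gv; elim/last_ind: s => [|s i IH].
  by rewrite expr0 mul1r.
rewrite rcons_uniq => /andP[is_ us]; rewrite size_rcons exprS -mulrA.
apply: (@le_trans _ _ (tau * avgs s h v)); first by rewrite ler_wpM2l ?IH.
rewrite -avgsZ /avgs foldr_rcons.
apply: (@avgs_le (fun v => v i \in good)) => // [j x w js|w].
  by rewrite upd_off //; apply: contraNneq is_ => ->.
exact: hgood.
Qed.

End Averaging.

(** * Cutting a sorted vertex set into pieces *)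

Section Pieces.

Variables (T : finType) (K P : nat) (k : T -> 'I_P).
Hypothesis K_gt0 : (0 < K)%N.

Let N := #|T|.
Let s := sort (relpre (fun x => nat_of_ord (k x)) leq) (enum T).
Let rank (x : T) := index x s.

Let s_uniq : uniq s. Proof. by rewrite sort_uniq enum_uniq. Qed.
Let s_mem x : x \in s. Proof. by rewrite mem_sort mem_enum. Qed.
Let s_size : size s = N. Proof. by rewrite size_sort -cardE. Qed.
Let rank_lt x : (rank x < N)%N. Proof. by rewrite -s_size index_mem. Qed.

Let piece_proof x : (rank x * K %/ N < K)%N.
Proof.
have N0 : (0 < N)%N by apply: leq_ltn_trans (rank_lt x).
by rewrite ltn_divLR // mulnC ltn_pmul2l.
Qed.

(** Vertices are listed with k nondecreasing, and the list is cut at equal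
    distances; a value of k is thus split only by cuts inside its run. *)
Definition piece (x : T) : 'I_K := Ordinal (piece_proof x).

Lemma piece_mono x y : (k x < k y)%N -> (piece x <= piece y)%N.
Proof.
move=> kxy; apply: leq_div2r; rewrite leq_mul2r; apply/orP; right.
rewrite leqNgt; apply/negP => yx.
have tr : transitive (relpre (fun x => nat_of_ord (k x)) leq).
  by move=> a b c; exact: leq_trans.
have sorted_s : sorted (relpre (fun x => nat_of_ord (k x)) leq) s.
  by apply: sort_sorted => a b; exact: leq_total.
have := sorted_ltn_nth tr x sorted_s (index y s) (index x s).
rewrite !inE !index_mem !s_mem !nth_index // => /(_ isT isT yx) /=.
by rewrite leqNgt kxy.
Qed.

Let card_rank_lt a : (a <= N)%N -> #|[set x | rank x < a]%N| = a.
Proof.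
move=> aN; transitivity (size (take a s)); last by rewrite size_takel ?s_size.
rewrite -(card_uniqP (take_uniq a s_uniq)).
by apply: eq_card => x; rewrite inE in_take.
Qed.

(** The vertices in pieces before the j-th are those of rank below
    ceil(j N / K), and consecutive values of this ceiling differ by N / K
    rounded down or up. *)
Lemma card_piece (i : 'I_K) :
  (N %/ K <= #|[set x | piece x == i]| <= (N %/ K).+1)%N.
Proof.
case: (posnP N) => [N0|N0].
  rewrite N0 div0n (_ : [set x | _] = set0) ?cards0 //.
  by apply/setP => x; have := rank_lt x; rewrite N0.
pose a j := ((j * N + K.-1) %/ K)%N.
have ltE j x : (rank x * K < j * N)%N = (rank x < a j)%N.
  by rewrite /a leq_divRL //; lia.
have aN j : (j <= K)%N -> (a j <= N)%N.
  by move=> jK; rewrite -ltnS ltn_divLR //; nia.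
have a_le : (a i <= a i.+1)%N by apply: leq_div2r; rewrite mulSn; lia.
have -> : [set x | piece x == i]
    = [set x | rank x < a i.+1]%N :\: [set x | rank x < a i]%N.
  apply/setP => x; rewrite !inE -!ltE -val_eqE /= eqn_leq.
  by rewrite -ltnS ltn_divLR // leq_divRL // -leqNgt andbC.
rewrite cardsD (setIidPr _); last first.
  by apply/subsetP => x; rewrite !inE => /leq_trans ->.
rewrite !card_rank_lt ?aN ?ltn_ord ?(ltnW (ltn_ord i)) //.
have -> : a i.+1 = (((i * N + K.-1) + N) %/ K)%N.
  by rewrite /a; congr (_ %/ _)%N; lia.
rewrite /a divnD // -addnA addKn leq_addr /= -addn1 leq_add2l; exact: leq_b1.
Qed.

Definition mixed (i : 'I_K) : bool :=
  [exists x, exists y, [&& piece x == i, piece y == i & k x != k y]].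

(** A mixed piece meets a value of k that is not the largest one it contains,
    and monotonicity makes these values distinct for distinct pieces. *)
Lemma card_mixed : (#|[set i | mixed i]| <= P)%N.
Proof.
have ex (i : 'I_K) : exists c : 'I_P.-1.+1, mixed i ->
    exists x y, [/\ piece x = i, piece y = i, (k x < k y)%N & c = k x :> nat].
  case mi: (mixed i); last by exists ord0.
  have /existsP[x /existsP[y /and3P[/eqP xi /eqP yi kxy]]] := mi.
  wlog lt_xy : x y xi yi kxy / (k x < k y)%N => [hw|].
    case: (ltngtP (k x) (k y)) => [|lt_yx|eq_xy]; first exact: hw.
      by apply: (hw y x) => //; rewrite eq_sym.
    by rewrite (val_inj eq_xy) eqxx in kxy.
  have kP : (k x < P.-1.+1)%N by have := ltn_ord (k x); lia.
  by exists (Ordinal kP) => _; exists x, y.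
have /fin_all_exists[c cP] := ex.
case: (posnP P) => [P0|P0].
  rewrite P0 leqn0 cards_eq0; apply/eqP/setP => i; rewrite !inE.
  apply/negbTE/negP => /(cP i)[x _]; have := ltn_ord (k x).
  by rewrite [X in (_ < X)%N]P0.
apply: (@leq_trans #|'I_P.-1.+1|); last by rewrite card_ord prednK.
rewrite -(card_in_imset (f := c)) ?max_card // => i j.
rewrite !inE => /(cP i)[x [y [xi yi xy cx]]].
move=> /(cP j)[x' [y' [xj yj xy' cx']]] cij.
apply/eqP; rewrite -val_eqE /=; apply: contraT => ij.
have kxx : k x = k x' :> nat by rewrite -cx -cx' cij.
have := piece_mono (x := x) (y := y'); have := piece_mono (x := x') (y := y).
rewrite xi yi xj yj -kxx xy kxx xy' => /(_ isT) a /(_ isT) b.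
by rewrite eqn_leq a b in ij.
Qed.

End Pieces.

(** * Counting the irregular tuples of pieces *)

(** Each factor of the falling factorial is at least K / 2. *)
Lemma expn_le_bin (K r : nat) :
  (2 * r <= K)%N -> (K ^ r <= 2 ^ r * r`! * 'C(K, r))%N.
Proof.
move=> rK; rewrite -mulnA (mulnC r`!) bin_ffact.
have H m : (m <= r)%N -> (K ^ m <= 2 ^ m * K ^_ m)%N.
  elim: m => // m IH mr; rewrite !expnSr ffactnSr.
  apply: (@leq_trans (2 ^ m * K ^_ m * K)).
    by rewrite leq_mul2r IH ?orbT // ltnW.
  rewrite -!mulnA leq_mul2l; apply/orP; right.
  rewrite [(2 * _)%N]mulnCA leq_mul2l; apply/orP; right; lia.
exact: H.
Qed.

Lemma bin_pred_le (K r : nat) :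
  (0 < r)%N -> (2 * r <= K)%N -> ('C(K, r.-1) * K <= 2 * r * 'C(K, r))%N.
Proof.
case: r => // r _ rK; rewrite /= -mulnA mul_bin_left mulnA mulnC.
by rewrite leq_mul2r; apply/orP; right; lia.
Qed.

Lemma card_sets_meeting (T : finType) (r : nat) (U : {set T}) :
  (0 < r)%N ->
  (#|[set I : {set T} | (#|I| == r) && (I :&: U != set0)]|
     <= #|U| * 'C(#|T|, r.-1))%N.
Proof.
move=> r0.
have sub : [set I : {set T} | (#|I| == r) && (I :&: U != set0)]
    \subset [set u.1 |: u.2 | u : T * {set T}
              in setX U [set A : {set T} | #|A| == r.-1]].
  apply/subsetP => I; rewrite inE => /andP[/eqP cI /set0Pn[i]].
  rewrite inE => /andP[iI iU]; apply/imsetP; exists (i, I :\ i).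
    by rewrite !inE iU /= -cI (cardsD1 i I) iI.
  by rewrite /= setD1K.
apply: leq_trans (subset_leq_card sub) (leq_trans (leq_imset_card _ _) _).
by rewrite cardsX card_draws.
Qed.

Section Boxes.

Variables (r K : nat) (T : finType) (pc : T -> 'I_K) (i0 : 'I_K).

Local Notation tuples := {ffun 'I_r -> T}.

(** Every r-set of parts is enumerated in one fixed order, which makes the
    boxes of distinct sets disjoint. *)
Definition box (I : {set 'I_K}) : {set tuples} :=
  [set v : tuples | [forall j, pc (v j) == nth i0 (enum I) j]].

Lemma card_box_ord (I : {set 'I_K}) :
  #|box I| = (\prod_(j < r) #|[set y | pc y == nth i0 (enum I) j]|)%N.
Proof.
transitivity #|(family (fun j : 'I_r =>
    mem [set y | pc y == nth i0 (enum I) j]) : {pred tuples})|.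
  apply: eq_card => v; rewrite inE; apply/forallP/familyP => H j;
    by have := H j; rewrite inE.
by rewrite card_family foldrE big_map big_enum.
Qed.

Lemma card_box (I : {set 'I_K}) : #|I| = r ->
  #|box I| = (\prod_(i in I) #|[set x | pc x == i]|)%N.
Proof.
move=> cI; rewrite card_box_ord -[RHS]big_enum [RHS](big_nth i0) -cardE cI.
by rewrite big_mkord.
Qed.

Lemma box_nth (I : {set 'I_K}) (j : 'I_r) : #|I| = r -> nth i0 (enum I) j \in I.
Proof. by move=> cI; rewrite -mem_enum mem_nth // -cardE cI. Qed.

Lemma box_index (I : {set 'I_K}) i :
  #|I| = r -> i \in I -> exists j : 'I_r, nth i0 (enum I) j = i.
Proof.
move=> cI iI; have jr : (index i (enum I) < r)%N.
  by rewrite -cI cardE index_mem mem_enum.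
by exists (Ordinal jr); rewrite /= nth_index // mem_enum.
Qed.

Lemma box_inj (I J : {set 'I_K}) v :
  #|I| = r -> #|J| = r -> v \in box I -> v \in box J -> I = J.
Proof.
move=> cI cJ; rewrite !inE => /forallP bI /forallP bJ.
apply/setP => i; rewrite -(mem_enum I) -(mem_enum J).
suff -> : enum I = enum J by [].
apply: (@eq_from_nth _ i0); rewrite -!cardE ?cI ?cJ // => j jr.
by have /eqP <- := bI (Ordinal jr); have /eqP <- := bJ (Ordinal jr).
Qed.

End Boxes.

Section Counting.

Variables (R : realFieldType) (r p K : nat) (T : finType).
Variables (cl : T -> 'I_p) (good : {set T}).
Variable phi : {ffun 'I_r -> T} -> bool.
Variables (eps tau gamma delta mu : R).
Hypotheses (r_gt0 : (0 < r)%N) (K_gt0 : (0 < K)%N).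

Local Notation tuples := {ffun 'I_r -> T}.
Let N := #|T|.
Let h (v : tuples) : R := (phi v)%:R.
Let theta : tuples -> R := avgs cl (enum 'I_r) h.

Hypothesis tau_ge0 : 0 <= tau.
Hypothesis trimmed :
  forall i (v : tuples), v i \in good -> tau * h v <= avg cl i h v.
Hypothesis delta_ge0 : 0 <= delta.
Hypothesis close : forall i x x', cl x = cl x' ->
  \sum_(v : tuples) `|h (upd i x v) - h (upd i x' v)| <= delta * N%:R ^+ r.
Hypothesis few_trimmed : #|~: good|%:R <= gamma * N%:R.

(** With a class of their own for the atypical vertices, a piece that contains
    vertices of both kinds is a mixed one. *)
Definition trimmed_class (x : T) : 'I_p.+1 :=
  if x \in good then lift ord0 (cl x) else ord0.

Let pc : T -> 'I_K := piece trimmed_class K_gt0.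

Let box : {set 'I_K} -> {set tuples} := box r pc (Ordinal K_gt0).

(** This contains the r-sets of [bad_tuples], but speaks of tuples of vertices
    only, so that it can be compared with theta. *)
Definition bad : {set {set 'I_K}} :=
  [set I : {set 'I_K} | [&& #|I| == r, [exists v in box I, phi v]
     & #|[set v in box I | phi v]|%:R < (1 - eps) * #|box I|%:R]].

Definition clean (i : 'I_K) : bool :=
  [forall x, (pc x == i) ==> (x \in good)] && ~~ mixed trimmed_class K_gt0 i.

Lemma sum_theta_dist :
  \sum_(v : tuples) `|theta v - h v| <= r%:R * (delta * N%:R ^+ r).
Proof.
rewrite -[X in X%:R * _](size_enum_ord r); apply: dist_avgs => //.
by rewrite mulr_ge0 // exprn_ge0.
Qed.

(** The lower bound that makes nearly empty tuples of parts exactly empty: an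
    edge on good vertices forces edge density at least tau^r on
    its classes. *)
Lemma theta_ge (v : tuples) :
  (forall i, v i \in good) -> phi v -> tau ^+ r <= theta v.
Proof.
move=> gv pv.
have := avgs_trimmed tau_ge0 (enum_uniq 'I_r) trimmed gv.
by rewrite size_enum_ord /h pv mulr1.
Qed.

Lemma clean_same_class i x y :
  clean i -> pc x = i -> pc y = i -> (x \in good) && (cl x == cl y).
Proof.
case/andP=> /forallP gi /existsPn mi xi yi.
have xg : x \in good by apply: (implyP (gi x)); apply/eqP.
have yg : y \in good by apply: (implyP (gi y)); apply/eqP.
rewrite xg /=; have /existsPn/(_ y) := mi x.
rewrite -/pc xi yi !eqxx /= negbK /trimmed_class xg yg.
by rewrite (inj_eq lift_inj).
Qed.

(** On a box of clean pieces theta is a constant, at least tau^r as soon as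
    the box contains an edge.  If this constant is at most 1/2, both values 0 and 1
    of h are at least that far from it.  Otherwise h is at distance more than
    1/2 from it at each of the more than eps * #|box I| non-edges. *)
Lemma box_deviation I :
  0 < eps -> mu <= tau ^+ r -> mu <= eps / 2 ->
  I \in bad -> {in I, forall i, clean i} ->
  mu * #|box I|%:R <= \sum_(v in box I) `|theta v - h v|.
Proof.
move=> eps0 mu1 mu2; rewrite inE.
move=> /and3P[/eqP cI /existsP[v0 /andP[bv0 pv0]] sparse] cleanI.
have nthI (j : 'I_r) := box_nth (Ordinal K_gt0) j cI.
have box_class v j : v \in box I -> (v j \in good) && (cl (v j) == cl (v0 j)).
  move: bv0; rewrite !inE => /forallP/(_ j)/eqP b0 /forallP/(_ j)/eqP b.
  exact: clean_same_class (cleanI _ (nthI j)) b b0.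
have thE v : v \in box I -> theta v = theta v0.
  move=> vb; apply: avgs_class => j; first by rewrite mem_enum.
  by case/andP: (box_class v j vb) => _ /eqP.
have th0 : tau ^+ r <= theta v0.
  by apply: theta_ge => // j; case/andP: (box_class v0 j bv0).
case: (lerP (theta v0) (1 / 2)) => th_half.
  rewrite mulr_natr -sumr_const; apply: ler_sum => v vb.
  rewrite (thE v vb) /h ler_normr; apply/orP.
  by case: (phi v); [right | left]; rewrite ?mulr1n ?mulr0n; lra.
apply: (@le_trans _ _ (\sum_(v in box I | ~~ phi v) (1 / 2))); last first.
  rewrite big_mkcondr; apply: ler_sum => v vb; rewrite (thE v vb) /h.
  case: (phi v) => //=; rewrite mulr0n subr0.
  by rewrite ler_normr; apply/orP; left; lra.
rewrite sumr_const.
have -> : #|[pred v in box I | ~~ phi v]|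
    = (#|box I| - #|[set v in box I | phi v]|)%N.
  rewrite -(cardsID [set v | phi v] (box I)).
  rewrite (_ : [set v in box I | phi v] = box I :&: [set v | phi v]).
    rewrite addKn; apply: eq_card => v; rewrite !inE andbC; congr (_ && _).
  by apply/setP => v; rewrite !inE.
have sub : (#|[set v in box I | phi v]| <= #|box I|)%N.
  by apply/subset_leq_card/subsetP => v; rewrite inE => /andP[].
rewrite -[(1 / 2) *+ _]mulr_natr natrB //.
have := ler_wpM2r (ler0n R #|box I|) mu2.
by lra.
Qed.

Lemma card_pc i x : pc x = i ->
  N%:R <= 2 * K%:R * #|[set y | pc y == i]|%:R :> R.
Proof.
move=> xi; have /andP[lo hi] := card_piece trimmed_class K_gt0 i.
have pos : (0 < #|[set y | pc y == i]|)%N.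
  by apply/card_gt0P; exists x; rewrite inE xi.
rewrite -!natrM ler_nat.
have := ltn_ceil N K_gt0; rewrite -/pc in lo; nia.
Qed.

Lemma card_box_ge I v0 : v0 \in box I ->
  N%:R ^+ r <= (2 * K%:R) ^+ r * #|box I|%:R :> R.
Proof.
rewrite inE => /forallP bv0; rewrite /box card_box_ord natr_prod.
have expE (a : R) : a ^+ r = \prod_(j < r) a by rewrite prodr_const card_ord.
rewrite !expE -big_split /=.
by apply: ler_prod => j _; rewrite ler0n (@card_pc _ (v0 j)) //; apply/eqP.
Qed.

(** The boxes are disjoint, so their deviations add up to at most the l1-distance
    of theta and h, whereas each box contains at least (N / 2K)^r tuples. *)
Lemma card_bad_clean :
  0 < eps -> 0 <= mu -> mu <= tau ^+ r -> mu <= eps / 2 ->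
  mu * #|[set I in bad | [forall i in I, clean i]]|%:R
    <= r%:R * delta * (2 * K%:R) ^+ r.
Proof.
move=> eps0 mu0 mu1 mu2; set S := [set I in bad | _].
have rhs0 : 0 <= r%:R * delta * (2 * K%:R) ^+ r :> R.
  by rewrite !mulr_ge0 // exprn_ge0 // mulr_ge0.
case: (posnP N) => [N0|N0].
  suff -> : S = set0 by rewrite cards0 mulr0.
  apply/setP => I; rewrite !inE; apply/negbTE; apply/negP.
  case/andP=> /and3P[_ /existsP[v _] _] _.
  by have := fintype0 (v (Ordinal r_gt0)) N0.
have N0' : 0 < N%:R ^+ r :> R by rewrite exprn_gt0 // ltr0n.
rewrite -(ler_pM2r N0').
apply: (@le_trans _ _ ((2 * K%:R) ^+ r
    * \sum_(I in S) \sum_(v in box I) `|theta v - h v|)).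
  rewrite mulrAC [_ * #|S|%:R]mulr_natr -sumr_const mulr_sumr.
  apply: ler_sum => I.
  rewrite inE => /andP[bI /forall_inP cI].
  have := box_deviation eps0 mu1 mu2 bI cI.
  move: (bI); rewrite inE => /and3P[_ /existsP[v0 /andP[vb _]] _] dev.
  apply: (@le_trans _ _ (mu * ((2 * K%:R) ^+ r * #|box I|%:R))).
    by rewrite ler_wpM2l // (card_box_ge vb).
  by rewrite mulrCA ler_wpM2l // exprn_ge0 // mulr_ge0.
rewrite [leRHS]mulrAC [leRHS]mulrC ler_wpM2l ?exprn_ge0 ?mulr_ge0 //.
apply: le_trans (le_trans sum_theta_dist _); last by rewrite mulrA.
rewrite (exchange_big_dep predT) //=; apply: ler_sum => v _.
case: (pickP (fun I => (I \in S) && (v \in box I))) => [I /andP[IS vI]|none].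
  rewrite (big_pred1 I) // => J /=; apply/idP/eqP => [/andP[JS vJ]|->].
    move: IS JS; rewrite !inE => /andP[/and3P[/eqP cI _ _] _].
    case/andP=> /and3P[/eqP cJ _ _] _.
    exact: box_inj cJ cI vJ vI.
  by rewrite IS.
by rewrite big_pred0.
Qed.

Definition dirty : {set 'I_K} :=
  [set i | ~~ clean i & [exists x, pc x == i]].

(** A nonempty piece that is not clean is either mixed or made of atypical
    vertices only. *)
Lemma card_dirty : (0 < N)%N ->
  #|dirty|%:R <= p.+1%:R + 2 * K%:R * gamma.
Proof.
move=> N0; have N0' : 0 < N%:R :> R by rewrite ltr0n.
pose M := [set i | mixed trimmed_class K_gt0 i].
pose G := dirty :\: M.
have cD : #|dirty|%:R <= p.+1%:R + #|G|%:R :> R.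
  rewrite -natrD ler_nat -(cardsID M dirty) leq_add2r.
  apply: leq_trans (card_mixed trimmed_class K_gt0).
  exact: subset_leq_card (subsetIr dirty M).
apply: le_trans cD _; rewrite lerD2l -(ler_pM2r N0').
apply: (@le_trans _ _ (2 * K%:R * (\sum_(i in G) #|[set y | pc y == i]|)%N%:R)).
  rewrite [leLHS]mulrC [leLHS]mulr_natr -sumr_const natr_sum mulr_sumr.
  apply: ler_sum => i.
  rewrite !inE => /and3P[_ _ /existsP[x /eqP xi]]; exact: card_pc xi.
rewrite -[leRHS]mulrA ler_wpM2l ?mulr_ge0 //; apply: le_trans few_trimmed.
rewrite ler_nat.
under eq_bigr => i _ do rewrite -sum1_card.
rewrite (exchange_big_dep predT) //= -sum1_card [leqRHS]big_mkcond.
apply: leq_sum => x _.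
case xg: (x \in good); rewrite inE xg /=; last first.
  rewrite sum1_card; apply: (@leq_trans #|[set pc x]|); last by rewrite cards1.
  apply/subset_leq_card/subsetP => i; rewrite inE => /andP[_].
  by rewrite !inE eq_sym.
rewrite big_pred0 // => i; apply/negbTE/negP => /andP[]; rewrite !inE.
case/and3P=> mi /negP ci _ /eqP xi; apply: ci; rewrite /clean mi andbT.
apply/forallP => y; apply/implyP => /eqP yi.
move: mi => /existsPn/(_ x)/existsPn/(_ y); rewrite -/pc xi yi !eqxx /= negbK.
rewrite /trimmed_class xg; case: (y \in good) => //.
Qed.

(** Half of the allowance pays for the sets that meet a dirty piece, the other
    half for the irregular sets of clean pieces. *)
Lemma card_bad :
  0 < eps -> 0 < mu -> mu <= tau ^+ r -> mu <= eps / 2 ->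
  (2 * r <= K)%N ->
  8 * r%:R * p.+1%:R <= eps * K%:R ->
  16 * r%:R * gamma <= eps ->
  2 * r%:R * delta * (4 ^ r * r`!)%:R <= eps * mu ->
  #|bad|%:R <= eps * 'C(K, r)%:R.
Proof.
move=> eps0 mu0 mu1 mu2 rK hp hg hd.
case: (posnP N) => [N0|N0].
  suff -> : bad = set0 by rewrite cards0 mulr_ge0 // ltW.
  apply/setP => I; rewrite !inE; apply/negbTE; apply/negP.
  case/and3P=> _ /existsP[v _] _.
  by have := fintype0 (v (Ordinal r_gt0)) N0.
set S := [set I in bad | [forall i in I, clean i]].
set M := [set I : {set 'I_K} | (#|I| == r) && (I :&: dirty != set0)].
have cover : bad \subset S :|: M.
  apply/subsetP => I bI; rewrite in_setU; apply/orP.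
  case cleanI: [forall i in I, clean i]; [left | right]; rewrite in_set.
    by rewrite bI.
  have /and3P[/eqP cI /existsP[v /andP[vb _]] _] : [&& #|I| == r,
      [exists v in box I, phi v]
    & #|[set v in box I | phi v]|%:R < (1 - eps) * #|box I|%:R].
    by rewrite inE in bI.
  rewrite cI eqxx; apply/set0Pn.
  have /forall_inPn[i iI ni] := negbT cleanI.
  exists i; rewrite inE iI inE ni; apply/existsP.
  have [j <-] := box_index (Ordinal K_gt0) cI iI.
  by exists (v j); move: vb; rewrite inE => /forallP/(_ j).
have h1 : #|bad|%:R <= #|S|%:R + #|M|%:R :> R.
  rewrite -natrD ler_nat; apply: leq_trans (subset_leq_card cover) _.
  exact: leq_card_setU.
apply: le_trans h1 _.
set X : R := 'C(K, r)%:R.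
have X0 : 0 <= X by [].
have K0 : 0 < K%:R :> R by rewrite ltr0n.
have r0 : 0 <= r%:R :> R by [].
have hS : #|S|%:R <= eps / 2 * X.
  rewrite -(ler_pM2l mu0); apply: le_trans (card_bad_clean eps0 (ltW mu0) mu1 mu2) _.
  apply: (@le_trans _ _ (r%:R * delta * (4 ^ r * r`!)%:R * X)).
    rewrite -!mulrA; do 2![apply: ler_wpM2l => //].
    rewrite /X -natrM -natrX -natrM ler_nat expnMn.
    rewrite (_ : 4 = 2 * 2)%N // expnMn -!mulnA leq_mul2l; apply/orP; right.
    by rewrite !mulnA expn_le_bin.
  have := ler_wpM2r X0 hd; lra.
have hM : #|M|%:R <= eps / 2 * X.
  have cM := card_sets_meeting dirty r_gt0; rewrite card_ord -/M in cM.
  rewrite -(ler_pM2r K0).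
  apply: (@le_trans _ _ (#|dirty|%:R * (2 * r%:R * X))).
    rewrite -!natrM ler_nat; apply: leq_trans (leq_mul cM (leqnn K)) _.
    by rewrite -mulnA leq_mul2l bin_pred_le ?orbT.
  have hd' : #|dirty|%:R * (2 * r%:R * X)
      <= (p.+1%:R + 2 * K%:R * gamma) * (2 * r%:R * X).
    by rewrite ler_wpM2r ?card_dirty // !mulr_ge0.
  apply: le_trans hd' _.
  have e1 := ler_wpM2r X0 hp.
  have e2 := ler_wpM2r (mulr_ge0 (ltW K0) X0) hg.
  lra.
lra.
Qed.

End Counting.

(** * Parts of a hypergraph *)

Section PartsOfHypergraph.

Variables (V : choiceType) (r K : nat) (H : hypergraph V r).
Let T : finType := vertices H.
Variables (pc : T -> 'I_K) (i0 : 'I_K).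

Local Notation tuples := {ffun 'I_r -> T}.

Definition is_edge (v : tuples) : bool :=
  [fset val (v i) | i : 'I_r]%fset \in edges H.

(** A repeated vertex would leave fewer than r elements in the image. *)
Lemma is_edge_inj (v : tuples) : is_edge v -> injective v.
Proof.
move=> /edge_uniform[_ cv] i j vij; apply/eqP; apply: contraT => ij.
suff : (r <= r.-1)%N by case: (r) i {v cv vij ij j} => [[]|r' _] //=; rewrite ltnn.
rewrite -{1}cv.
apply: (@leq_trans #|` [fset val (v k) | k in [set k | k != j]]%fset|).
  apply: fsubset_leq_card; apply/fsubsetP => x /imfsetP[k _ ->].
  case: (eqVneq k j) => [->|kj]; apply/imfsetP; last by exists k; rewrite // inE.
  by exists i; rewrite ?inE // vij.
apply: leq_trans (leq_imfset_card _ _ _) _.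
rewrite -cardE (_ : [set k | k != j] = ~: [set j]).
  by rewrite cardsC1 card_ord.
by apply/setP => k; rewrite !inE.
Qed.

Definition part (i : 'I_K) : {fset V} :=
  [fset val x | x in [set x : T | pc x == i]]%fset.

Lemma mem_part (i : 'I_K) (x : T) : (val x \in part i) = (pc x == i).
Proof.
apply/imfsetP/idP => [[y /=]|xi]; last by exists x; rewrite ?inE.
by rewrite inE => yi /val_inj ->.
Qed.

Lemma partP (i : 'I_K) z : z \in part i -> exists2 x : T, z = val x & pc x = i.
Proof. by case/imfsetP => x /=; rewrite inE => /eqP xi ->; exists x. Qed.

Lemma card_part i : #|` part i| = #|[set x | pc x == i]|.
Proof. by rewrite card_imfset /= ?cardE //; exact: val_inj. Qed.

Lemma parts_equitable m :
  (forall i, m <= #|[set x | pc x == i]| <= m.+1)%N ->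
  equitable_partition H part.
Proof.
move=> sizes; split.
- move=> z; apply/idP/existsP => [zH|[i /partP[x -> _]]]; last exact: valP.
  by exists (pc (Sub z zH)); have := mem_part (pc (Sub z zH)) (Sub z zH);
    rewrite eqxx SubK.
- move=> i j ij; apply/fdisjointP => z /partP[x -> xi].
  by rewrite mem_part xi.
- move=> i j; rewrite !card_part.
  have /andP[_ hi] := sizes i; have /andP[lo _] := sizes j.
  exact: leq_trans hi _.
Qed.

Lemma crossing_edges_box (I : {set 'I_K}) e :
  #|I| = r -> e \in crossing_edges H part I ->
  exists2 v, v \in box r pc i0 I & is_edge v.
Proof.
move=> cI; rewrite !inE /= => /andP[eH /forall_inP cross].
have [sub ce] := edge_uniform eH.
have ex (j : 'I_r) : exists x : T, val x \in e /\ pc x = nth i0 (enum I) j.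
  have /cardfs1P[z ez] := cross _ (box_nth i0 j cI).
  have : z \in (e `&` part (nth i0 (enum I) j))%fset by rewrite ez inE.
  by rewrite inE => /andP[ze /partP[x zx xj]]; exists x; rewrite -zx.
have /fin_all_exists[v0 v0P] := ex; pose v : tuples := [ffun j => v0 j].
have vI : v \in box r pc i0 I.
  by rewrite inE; apply/forallP => j; rewrite ffunE; have [_ ->] := v0P j.
exists v => //; suff eE : e = [fset val (v i) | i : 'I_r]%fset.
  by rewrite /is_edge -eE.
apply/eqP; rewrite eq_sym eqEfcard; apply/andP; split.
  by apply/fsubsetP => z /imfsetP[j _ ->]; rewrite ffunE; have [] := v0P j.
rewrite ce card_imfset /=; first by rewrite -cardE card_ord.
move=> j k /val_inj; rewrite !ffunE => vjk; apply: val_inj.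
have : nth i0 (enum I) j = nth i0 (enum I) k.
  by have [_ <-] := v0P j; have [_ <-] := v0P k; rewrite vjk.
by move/eqP; rewrite nth_uniq ?enum_uniq -?cardE ?cI // => /eqP.
Qed.

Lemma box_crossing_edges (I : {set 'I_K}) :
  #|I| = r ->
  (#|[set v in box r pc i0 I | is_edge v]| <= #|` crossing_edges H part I|)%N.
Proof.
move=> cI; pose img (v : tuples) := [fset val (v i) | i : 'I_r]%fset.
have img_mem (v : tuples) z :
    z \in img v = [exists i, z == val (v i)].
  apply/imfsetP/existsP => [[i _ ->]|[i /eqP ->]]; exists i => //.
have img_inj : {in [set v in box r pc i0 I | is_edge v] &, injective img}.
  move=> v w; rewrite !inE => /andP[/forallP bv _] /andP[/forallP bw _] vw.
  apply/ffunP => j; have : val (w j) \in img v.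
    by rewrite vw img_mem; apply/existsP; exists j.
  rewrite img_mem => /existsP[k /eqP/val_inj wjk]; rewrite wjk; congr (v _).
  apply: val_inj; have := eqP (bw j); rewrite wjk (eqP (bv k)) => /eqP.
  by rewrite nth_uniq ?enum_uniq -?cardE ?cI // => /eqP.
have -> : #|[set v in box r pc i0 I | is_edge v]|
    = #|` [fset img v | v in [set v in box r pc i0 I | is_edge v]]%fset|.
  by rewrite card_in_imfset /= -?cardE //.
apply: fsubset_leq_card; apply/fsubsetP => e /imfsetP[v /=].
rewrite !inE => /andP[/forallP bv ev] -> /=; apply/andP; split => //.
apply/forall_inP => i iI; have [j ji] := box_index i0 cI iI.
apply/cardfs1P; exists (val (v j)); apply/fsetP => z; rewrite !inE img_mem.
apply/andP/eqP => [[/existsP[k /eqP ->]]|->].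
  rewrite mem_part (eqP (bv k)) -ji nth_uniq ?enum_uniq -?cardE ?cI // => /eqP kj.
  by congr (val (v _)); apply: val_inj.
split; first by apply/existsP; exists j.
by rewrite mem_part (eqP (bv j)) ji.
Qed.

Lemma bad_tuples_box (R : realFieldType) (eps : R) (I : {set 'I_K}) :
  I \in bad_tuples H part eps ->
  [&& #|I| == r, [exists v in box r pc i0 I, is_edge v]
     & #|[set v in box r pc i0 I | is_edge v]|%:R
         < (1 - eps) * #|box r pc i0 I|%:R].
Proof.
rewrite inE negb_or => /and3P[/eqP cI ne].
rewrite -ltNge /density cI eqxx /=.
have -> : (\prod_(i in I) #|` part i|)%N = #|box r pc i0 I|.
  by rewrite card_box //; apply: eq_bigr => i _; exact: card_part.
have [v vI ev] : exists2 v, v \in box r pc i0 I & is_edge v.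
  have /fset0Pn[e eI] := ne; exact: crossing_edges_box cI eI.
have box0 : 0 < #|box r pc i0 I|%:R :> R.
  by rewrite ltr0n; apply/card_gt0P; exists v.
rewrite ltr_pdivrMr // => dens; apply/andP; split.
  by apply/existsP; exists v; rewrite vI.
by apply: le_lt_trans dens; rewrite ler_nat box_crossing_edges.
Qed.

End PartsOfHypergraph.

(** * Atypical points and link polynomials *)

Section Trimming.

Variables (R : realFieldType) (F : fieldType) (n : nat) (T : finType).
Variables (pt : T -> 'rV[F]_n) (Y C : finType) (D : nat).
Variables (g : Y -> C -> T -> F).
Hypothesis g_poly : forall y c, polyfun pt D (g y c).
Variables (p : nat) (cl : T -> 'I_p) (tau : R).
Hypothesis tau_ge0 : 0 <= tau.

(** A function that does not vanish at a typical point is nonzero on a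
    tau-fraction of its class: this is what [avgs_trimmed] asks of a good
    point. *)
Definition typical : {set T} :=
  [set x | [forall y, forall c,
    (#|[set z in cls cl x | g y c z != 0%R]|%:R < tau * #|cls cl x|%:R)
      ==> (g y c x == 0)]].

Lemma card_atypical : #|~: typical|%:R <= (D.+1 ^ n)%:R * tau * #|T|%:R.
Proof.
pose A (a : 'I_p) := [set x | cl x == a].
pose B (a : 'I_p) := [set x in A a | [exists i : Y * C,
   (#|[set y in A a | g i.1 i.2 y != 0%R]|%:R < tau * #|A a|%:R)
     && (g i.1 i.2 x != 0)]].
have B_le a : #|B a|%:R <= (D.+1 ^ n)%:R * (tau * #|A a|%:R).
  apply: (few_exceptional_points (pt := pt)) => [|i]; last exact: g_poly.
  by rewrite mulr_ge0.
have cover : ~: typical \subset \bigcup_a B a.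
  apply/subsetP => x; rewrite !inE => /forallPn[y /forallPn[c]].
  rewrite negb_imply => nx; apply/bigcupP; exists (cl x) => //.
  by rewrite !inE eqxx; apply/existsP; exists (y, c).
apply: (@le_trans _ _ (\sum_a #|B a|)%N%:R).
  rewrite ler_nat; apply: leq_trans (subset_leq_card cover) _.
  exact: card_bigcup_le.
have -> : #|T|%:R = \sum_a #|A a|%:R :> R.
  rewrite -natr_sum; congr _%:R; rewrite -sum1_card.
  rewrite (partition_big cl predT) //=; apply: eq_bigr => a _.
  by rewrite -sum1_card; apply: eq_bigl => x; rewrite inE.
rewrite natr_sum mulr_sumr; apply: ler_sum => a _.
by rewrite -mulrA.
Qed.

End Trimming.

Section LinkPolynomials.

Variables (F : fieldType) (n r d : nat) (H : hypergraph 'rV[F]_n r).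
Variable f : {mpoly F[r * n]}.
Hypothesis n_gt0 : (0 < n)%N.
Hypothesis f_deg : (msize f <= d.+1)%N.
Hypothesis f_edges : forall v : 'I_r -> 'rV[F]_n,
  injective v -> (forall i, v i \in vertices H) ->
  ([fset v i | i : 'I_r]%fset \in edges H <-> eval_pts f v != 0).

Let T : finType := vertices H.
Local Notation tuples := {ffun 'I_r -> T}.
Let pt (x : T) : 'rV[F]_n := val x.

Definition injective_off (i : 'I_r) (v : tuples) : bool :=
  [forall j, forall k, [&& j != i, k != i & j != k] ==> (v j != v k)].

(** Being an edge also requires the vertices to be distinct, which one
    polynomial cannot express over a small field.  The choice of coordinates c
    takes care of that: x differs from v j when it differs in some coordinate,
    so the links for all c vanish at x together exactly when the tuple v with
    coordinate i replaced by x is no edge. *)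
Definition link (y : 'I_r * tuples) (c : {ffun 'I_r -> 'I_n}) (x : T) : F :=
  if injective_off y.1 y.2 then
    eval_pts f (fun j => pt (upd y.1 x y.2 j))
      * \prod_(j | j != y.1) (pt x 0 (c j) - pt (y.2 j) 0 (c j))
  else 0.

Lemma link_poly y c : polyfun pt (d + r) (link y c).
Proof.
rewrite /link; case: injective_off; last first.
  exact: polyfun_leq (leq0n _) (polyfun_const pt 0).
apply: polyfun_mul; last first.
  apply: polyfun_leq (polyfun_prod _ (D := fun=> 1%N) _).
    rewrite sum1_card; apply: leq_trans (max_card _) _; by rewrite card_ord.
  move=> j _; apply: polyfun_sub; first exact: polyfun_coord.
  exact: polyfun_leq (leq0n _) (polyfun_const pt _).
pose M x := \matrix_(j < r) pt (upd y.1 x y.2 j).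
have coord_poly k : polyfun pt 1 (fun x => mxvec (M x) 0 k).
  case/mxvec_indexP: k => a b.
  have [->|ay] := eqVneq a y.1.
    apply: polyfun_eq (polyfun_coord pt b) => x.
    by rewrite mxvecE mxE upd_at.
  apply: polyfun_leq (leq0n _) _.
  apply: polyfun_eq (polyfun_const pt (pt (y.2 a) 0 b)) => x.
  by rewrite mxvecE mxE upd_off.
apply: (@polyfun_eq _ _ _ _ _ (fun x => \sum_(m <- msupp f | m \in msupp f)
    f@_m * \prod_k mxvec (M x) 0 k ^+ m k)).
  by move=> x; rewrite /eval_pts mevalE [RHS]big_seq.
apply: polyfun_sum => m mf; apply: polyfun_scale.
apply: polyfun_leq (polyfun_prod _ (fun k _ => polyfun_exp (m k) (coord_poly k))).
under eq_bigr => k _ do rewrite muln1.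
by rewrite -ltnS -mdegE; apply: leq_trans (msize_mdeg_lt mf) f_deg.
Qed.

Lemma link_edge (i : 'I_r) (v : tuples) (x : T) :
  is_edge (upd i x v) = [exists c, link (i, v) c x != 0].
Proof.
apply/idP/existsP => [edge|[c]].
  have inj := is_edge_inj edge.
  have off : injective_off i v.
    apply/forallP => j; apply/forallP => k; apply/implyP => /and3P[ji ki jk].
    apply: contraNneq jk => vjk; apply/eqP/inj.
    by rewrite !upd_off.
  have ex j : exists b : 'I_n, (j != i) ==> (pt x 0 b != pt (v j) 0 b).
    case: (eqVneq j i) => [_|ji]; first by exists (Ordinal n_gt0).
    apply/existsP; apply: contraT => /existsPn same.
    have xv : x = v j.
      apply: val_inj; apply/rowP => b.
      by have := same b; rewrite negbK => /eqP.
    case/eqP: ji; apply: inj; rewrite upd_at xv.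
    by rewrite /upd ffunE; case: eqP.
  have /fin_all_exists[c cP] := ex; exists [ffun j => c j].
  rewrite /link off mulf_neq0 //.
    by apply/(f_edges _ _) => [j k /val_inj/inj|j|] //; exact: valP.
  rewrite prodf_seq_neq0; apply/allP => j _; apply/implyP => ji.
  by rewrite ffunE subr_eq0 (implyP (cP j)).
rewrite /link /=; case off: injective_off; last by rewrite eqxx.
rewrite mulf_eq0 negb_or => /andP[fx]; rewrite prodf_seq_neq0 => /allP prod0.
have xv j : j != i -> x != v j.
  move=> ji; have := prod0 j (mem_index_enum _); rewrite ji subr_eq0 /=.
  by apply: contraNneq => ->.
have inj : injective (upd i x v).
  move=> j k; case: (eqVneq j i) (eqVneq k i) => [->|ji] [->|ki] //.
  - by rewrite upd_at upd_off // => /eqP; rewrite (negbTE (xv _ ki)).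
  - by rewrite upd_at upd_off // => /esym/eqP; rewrite (negbTE (xv _ ji)).
  - rewrite !upd_off // => vjk; apply/eqP; apply: contraT => jk.
    have /forallP/(_ j)/forallP/(_ k) := off.
    by rewrite ji ki jk vjk eqxx.
by apply/(f_edges _ _) => [j k /val_inj/inj|j|] //; exact: valP.
Qed.

End LinkPolynomials.

(** * Choice of the parameters *)

Section Assembly.

Variables (R : archiRealFieldType) (F : fieldType) (n r d : nat).
Variables (H : hypergraph 'rV[F]_n r) (f : {mpoly F[r * n]}).
Hypothesis n_gt0 : (0 < n)%N.
Hypothesis f_deg : (msize f <= d.+1)%N.
Hypothesis f_edges : forall v : 'I_r -> 'rV[F]_n,
  injective v -> (forall i, v i \in vertices H) ->
  ([fset v i | i : 'I_r]%fset \in edges H <-> eval_pts f v != 0).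

Let T : finType := vertices H.
Local Notation tuples := {ffun 'I_r -> T}.
Let h (v : tuples) : R := (is_edge v)%:R.
Let g := link f (H := H).
Let g_poly := link_poly (H := H) f_deg.
Let edge_link := link_edge n_gt0 f_edges.

(** If v is an edge, some link is nonzero at v i, and then, v i being typical,
    on at least a tau-fraction of the class of v i. *)
Lemma typical_trimmed p (cl : T -> 'I_p) (tau : R) (i : 'I_r) (v : tuples) :
  0 <= tau -> v i \in typical g cl tau -> tau * h v <= avg cl i h v.
Proof.
move=> tau0 vi; rewrite /h; case ev: (is_edge v); last first.
  rewrite mulr0 mulr_ge0 ?invr_ge0 //; apply: sumr_ge0 => x _; exact: ler0n.
have := edge_link i v (v i); rewrite upd_id ev => /esym/existsP[c gc].
move: vi; rewrite inE => /forallP/(_ (i, v))/forallP/(_ c).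
rewrite (negbTE gc) implybF -leNgt mulr1 => le_tau.
rewrite /avg ler_pdivlMr ?cls_gt0 //; apply: le_trans le_tau _.
rewrite -natr_sum ler_nat -sum1_card big_mkcond [leqRHS]big_mkcond /=.
apply: leq_sum => x _; rewrite inE; case: (x \in cls cl (v i)) => //=.
case gx: (g (i, v) c x != 0) => //.
suff -> : is_edge (upd i x v) by [].
by rewrite edge_link; apply/existsP; exists c.
Qed.

Lemma sum_dist_card (i : 'I_r) (x x' : T) :
  \sum_(v : tuples) `|h (upd i x v) - h (upd i x' v)|
    = #|[set v : tuples | is_edge (upd i x v) != is_edge (upd i x' v)]|%:R.
Proof.
rewrite -sum1_card [in RHS]big_mkcond natr_sum; apply: eq_bigr => v _.
rewrite inE /h; case: (is_edge _); case: (is_edge _) => /=;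
  by rewrite ?subrr ?normr0 ?subr0 ?sub0r ?normrN ?normr1.
Qed.

Lemma edge_classes (delta : R) : 0 < delta -> delta <= 1 ->
  exists p (cl : T -> 'I_p),
    p%:R ^+ 3 * delta ^+ (4 * n)
      <= ((2 * (16 * n * n ^ r * (d + r)).+1) ^ (4 * n))%:R :> R /\
    forall i x x', cl x = cl x' ->
      \sum_(v : tuples) `|h (upd i x v) - h (upd i x' v)|
        <= 2 * r%:R * delta * #|T|%:R ^+ r.
Proof.
move=> d0 d1; have [p [cl [hp cl_close]]] := packing_classes g_poly n_gt0 d0 d1.
exists p, cl; split.
  by move: hp; rewrite card_ffun !card_ord.
move=> i x x' /cl_close; rewrite sum_dist_card.
rewrite card_prod card_ffun !card_ord natrM natrX => close.
rewrite (_ : 2 * r%:R * delta * _ = 2 * delta * (r%:R * #|T|%:R ^+ r)); last by ring.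
apply: le_trans close.
have pair_inj : injective (fun v : tuples => (i, v)) by move=> v w [].
rewrite ler_nat -(card_imset _ pair_inj).
apply/subset_leq_card/subsetP => y /imsetP[v]; rewrite inE => ev ->.
by rewrite inE -!edge_link.
Qed.

(** For r = 1 the two classes of edges and non-edges leave no error at all;
    the packing bound would be too weak for the exponent 2n + 1. *)
Lemma edge_classes_unary (delta : R) : r = 1%N -> 0 <= delta ->
  exists cl : T -> 'I_2,
    forall i x x', cl x = cl x' ->
      \sum_(v : tuples) `|h (upd i x v) - h (upd i x' v)|
        <= delta * #|T|%:R ^+ r.
Proof.
move=> r1 d0.
exists (fun x => inord (is_edge [ffun=> x])) => i x x' /(congr1 val).
rewrite /= !inordK ?ltnS ?leq_b1 // => exx.
have updE z (v : tuples) : upd i z v = [ffun=> z].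
  apply/ffunP => j; rewrite !ffunE (_ : j = i) ?eqxx //.
  by apply: val_inj => /=; have := ltn_ord i; have := ltn_ord j; clear -r1; lia.
rewrite big1 => [|v _]; first by rewrite mulr_ge0 // exprn_ge0.
by rewrite /h !updE exx subrr normr0.
Qed.

End Assembly.

(** For r >= 2 the exponent in the statement exceeds the packing exponent
    4n(r + 1)/3 by at least 1, which pays for the equitable refinement. *)
Lemma exponent_slack (n r : nat) : (0 < n)%N -> (1 < r)%N ->
  (r.+1 * (4 * n) <= (r`! * (2 * n + 1)).-1 * 3)%N.
Proof.
move=> n0; case: r => [|[|[|r]]] // _; first by rewrite /= !factS fact0; lia.
have h : (r.+3 * 2 <= r.+3`!)%N.
  rewrite !factS; have := fact_gt0 r; nia.
move: h; set a := _`!; nia.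
Qed.

(** The factor B / A + 2 exceeds 1, so its cube dominates it and the cube root
    can be taken without real exponents. *)
Lemma class_count_le (R : realFieldType) (p A B eps : R) (a e : nat) :
  0 < A -> 0 <= B -> 0 < eps -> eps <= 1 -> (a <= e * 3)%N ->
  p ^+ 3 * (A * eps ^+ a) <= B -> p <= (B / A + 2) * (1 / eps) ^+ e.
Proof.
move=> A0 B0 eps0 eps1 ae pB; rewrite leNgt; apply/negP => p_big.
have q0 : 0 <= B / A by rewrite divr_ge0 // ltW.
have x1 : 1 <= 1 / eps by rewrite ler_pdivlMr // mul1r.
have x0 : 0 <= 1 / eps by apply: le_trans x1.
have q1 : 1 <= B / A + 2 by lra.
have ea0 : 0 < eps ^+ a by rewrite exprn_gt0.
suff : B < B by rewrite ltxx.
apply: (@lt_le_trans _ _ (p ^+ 3 * (A * eps ^+ a))) => //.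
apply: (@lt_le_trans _ _ (((B / A + 2) * (1 / eps) ^+ a) * (A * eps ^+ a))).
  have -> : (B / A + 2) * (1 / eps) ^+ a * (A * eps ^+ a) = B + 2 * A.
    rewrite expr_div_n expr1n; field; rewrite ?gt_eqF //.
  by lra.
rewrite ler_pM2r ?mulr_gt0 //.
apply: (@le_trans _ _ (((B / A + 2) * (1 / eps) ^+ e) ^+ 3)); last first.
  apply: lerXn2r; rewrite ?nnegrE; last exact: ltW.
    by rewrite mulr_ge0 ?exprn_ge0 // (le_trans _ q1).
  by apply: le_trans (ltW p_big); rewrite mulr_ge0 ?exprn_ge0 // (le_trans _ q1).
rewrite [leRHS]exprMn -exprM; apply: ler_pM; rewrite ?exprn_ge0 //.
- by rewrite (le_trans _ q1).
- by rewrite -[leLHS]expr1; apply: ler_weXn2l.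
- exact: ler_weXn2l.
Qed.

Theorem theorem1p5 (R : realType) (r n d : nat)
    (r_gt0 : (0 < r)%N) (n_gt0 : (0 < n)%N) (d_gt0 : (0 < d)%N) :
  exists c : R, forall eps : R, 0 < eps -> eps < 1 / 4 ->
  forall (F : fieldType) (H : hypergraph 'rV[F]_n r),
  strongly_algebraic d H ->
  exists (K : nat) (V : 'I_K -> {fset 'rV[F]_n}),
    [/\ equitable_partition H V,
        8 / eps < K%:R,
        K%:R < c * (1 / eps) ^+ (r`! * (2 * n + 1))
      & #|bad_tuples H V eps|%:R <= eps * 'C(K, r)%:R].
Proof.
pose t : R := 16 * r%:R * ((d + r).+1 ^ n)%:R.
pose w : R := (4 ^ r * r`!)%:R.
pose A : R := (4 * r%:R ^+ 2 * w * t ^+ r)^-1.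
pose B : R := ((2 * (16 * n * n ^ r * (d + r)).+1) ^ (4 * n))%:R.
pose Q : R := B / A ^+ (4 * n) + 2.
pose c0 : R := 8 * r%:R * (Q + 1) + 2 * r%:R + 9.
set E := (r`! * (2 * n + 1))%N.
have r1 : 1 <= r%:R :> R by rewrite ler1n.
have t16 : 16 <= t.
  have : 1 <= ((d + r).+1 ^ n)%:R :> R by rewrite ler1n expn_gt0.
  by rewrite /t; nra.
have t0 : 0 < t by lra.
have w1 : 1 <= w by rewrite ler1n muln_gt0 expn_gt0 fact_gt0.
have tr1 : 1 <= t ^+ r by rewrite exprn_ege1 //; lra.
have Ai1 : 1 <= 4 * r%:R ^+ 2 * w * t ^+ r.
  rewrite -[leLHS]mulr1; apply: ler_pM => //.
  rewrite -[leLHS]mulr1; apply: ler_pM => //.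
  have : 1 <= r%:R ^+ 2 :> R by rewrite exprn_ege1.
  by lra.
have A0 : 0 < A by rewrite invr_gt0; lra.
have A1 : A <= 1 by rewrite invf_le1 //; lra.
have Q2 : 2 <= Q.
  have : 0 <= B / A ^+ (4 * n) by rewrite divr_ge0 // exprn_ge0 // ltW.
  by rewrite /Q; lra.
have E_gt0 : (0 < E)%N by rewrite muln_gt0 fact_gt0 addn1.
exists (c0 + 2) => eps eps0 eps_lt F H [f f_deg f_inv].
have f_edges v : injective v -> (forall i, v i \in vertices H) ->
    ([fset v i | i : 'I_r]%fset \in edges H <-> eval_pts f v != 0).
  by move=> vi vH; have [] := f_inv v vi vH.
pose X := 1 / eps.
have X1 : 1 <= X by rewrite ler_pdivlMr // mul1r; lra.
have epsX : eps * X = 1 by rewrite /X; field; rewrite gt_eqF.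
(* tau makes the atypical vertices an eps/16r-fraction of all vertices. *)
pose tau := eps / t.
have tau0 : 0 < tau by rewrite divr_gt0.
have tau_eps : tau <= eps / 16.
  by rewrite ler_pdivrMr // ; nra.
pose mu := tau ^+ r.
have mu0 : 0 < mu by rewrite exprn_gt0.
have mu_tau : mu <= tau.
  rewrite /mu -(prednK r_gt0) exprS ler_piMr ?(ltW tau0) //.
  by rewrite exprn_ile1 ?(ltW tau0) //; lra.
(* delta makes the l1-error small against mu times the number of r-sets; w
   compares K^r with the binomial coefficient 'C(K, r). *)
pose delta := eps * mu / (2 * r%:R * w).
have rw0 : 0 < 2 * r%:R * w by rewrite !mulr_gt0 //; lra.
have delta0 : 0 < delta by rewrite divr_gt0 // mulr_gt0.
have deltaE : delta = 2 * r%:R * (A * eps ^+ r.+1).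
  rewrite /delta /mu /tau /A exprMn exprVn [eps ^+ r.+1]exprS; field.
  by rewrite !gt_eqF ?exprn_gt0 ?ltr0n ?expn_gt0 ?fact_gt0.
have delta1 : A * eps ^+ r.+1 <= 1.
  have : eps ^+ r.+1 <= 1 by rewrite exprn_ile1 ?ltW //; lra.
  have : 0 <= eps ^+ r.+1 by rewrite exprn_ge0 // ltW.
  by nra.
pose T : finType := vertices H.
pose h (v : {ffun 'I_r -> T}) : R := (is_edge v)%:R.
have [p [cl [p_le close]]] : exists p (cl : T -> 'I_p),
    p%:R <= Q * X ^+ E.-1 /\
    forall i x x', cl x = cl x' ->
      \sum_(v : {ffun 'I_r -> T}) `|h (upd i x v) - h (upd i x' v)|
        <= delta * #|T|%:R ^+ r.
  have [r_eq1|r_ne1] := eqVneq r 1%N.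
    have [cl cl_close] := edge_classes_unary (R := R) H r_eq1 (ltW delta0).
    exists 2, cl; split=> //.
    have : 1 <= X ^+ E.-1 by rewrite exprn_ege1.
    by nra.
  have ddelta0 : 0 < A * eps ^+ r.+1 by rewrite mulr_gt0 // exprn_gt0.
  have [p [cl [p3 cl_close]]] :=
    edge_classes n_gt0 f_deg f_edges ddelta0 delta1.
  exists p, cl; split=> [|i x x' xx]; last by rewrite deltaE; apply: cl_close.
  apply: (class_count_le (a := r.+1 * (4 * n))) => //.
  - by rewrite exprn_gt0.
  - by lra.
  - by apply: exponent_slack => //; case: (r) r_gt0 r_ne1 => [|[|]].
  - by rewrite [eps ^+ _]exprM -exprMn.
pose good := typical (link f (H := H)) cl tau.
pose K := (Num.truncn (c0 * X ^+ E)).+1.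
have XE : X ^+ E = X * X ^+ E.-1 by rewrite -exprS prednK.
have XE1 : 1 <= X ^+ E.-1 by rewrite exprn_ege1.
have K_lo : c0 * X ^+ E < K%:R by rewrite truncnS_gt.
have cX0 : 0 <= c0 * X ^+ E.
  by rewrite mulr_ge0 ?exprn_ge0 //; [rewrite /c0; nra | lra].
have K_hi : K%:R <= c0 * X ^+ E + 1.
  by rewrite -natr1 lerD2r truncn_le.
have XEX : X <= X ^+ E by rewrite XE; nra.
have c0_ge : 9 + 2 * r%:R <= c0 by rewrite /c0; nra.
have K_gt0 : (0 < K)%N by [].
exists K, (part (piece (trimmed_class cl good) K_gt0)); split.
- apply: parts_equitable => i; exact: card_piece.
- apply: le_lt_trans K_lo; have -> : 8 / eps = 8 * X by rewrite /X mul1r.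
  by apply: ler_pM => //; lra.
- apply: le_lt_trans K_hi _; rewrite -/X; nra.
apply: (@le_trans _ _ #|bad (r := r) cl good (@is_edge _ _ H) eps K_gt0|%:R).
  rewrite ler_nat; apply/subset_leq_card/subsetP => I.
  move=> /bad_tuples_box - /(_ (Ordinal K_gt0)).
  by rewrite inE.
apply: (@card_bad R r p K T cl good _ eps tau
  (((d + r).+1 ^ n)%:R * tau) delta mu) => //.
- exact: ltW.
- by move=> i v; apply: (typical_trimmed n_gt0 f_edges); exact: ltW.
- exact: ltW.
- have g_poly := link_poly (H := H) f_deg.
  exact: (card_atypical g_poly cl (ltW tau0)).
- by lra.
- rewrite -(ler_nat R) natrM; apply: le_trans (ltW K_lo).
  by apply: (@le_trans _ _ c0); [lra | rewrite ler_peMr //; lra].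
- have epsK : c0 * X ^+ E.-1 <= eps * K%:R.
    apply: le_trans (ler_wpM2l (ltW eps0) (ltW K_lo)).
    by rewrite XE mulrCA [eps * _]mulrA epsX mul1r.
  apply: le_trans epsK.
  apply: (@le_trans _ _ (8 * r%:R * ((Q + 1) * X ^+ E.-1))).
    by rewrite ler_wpM2l ?mulr_ge0 // -natr1 mulrDl mul1r lerD.
  rewrite mulrA ler_wpM2r ?(le_trans _ XE1) //.
  by rewrite /c0; lra.
- rewrite le_eqVlt; apply/orP; left; apply/eqP.
  by rewrite mulrA -/t mulrC divfK // gt_eqF.
- rewrite -/w le_eqVlt; apply/orP; left; apply/eqP; rewrite /delta mulrAC mulrC.
  by rewrite divfK // gt_eqF.
Qed.
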